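(* Fix an integer $d\geq 2$. Given sets $A$ and $B$, each consisting of $N$ vectors in $\{0,1\}^D$, one can construct two rooted trees $H=H(A)$ (depending only on $A$) and $G=G(B)$ (depending only on $B$) such that: (1) both trees have $O(ND)$ vertices and the construction takes $O(ND)$ time; (2) every vertex of both trees has at most $d$ children; (3) the depth of both trees is at most $2\log_d N+O(\log D)$; (4) $H$ is isomorphic to a subtree of $G$ if and only if there exist $\alpha\in A$ and $\beta\in B$ with $\alpha\cdot\beta=0$.
   Context: For rooted trees $H$ and $G$, $H$ is isomorphic to a subtree of $G$ if there is an injective map $f$ from the vertices of $H$ to the vertices of $G$ with $f(\mathrm{root}(H))=\mathrm{root}(G)$ such that whenever $c$ is a child of $p$ in $H$, $f(c)$ is a child of $f(p)$ in $G$. The depth of a rooted tree is the maximum number of edges on a root-to-leaf path. For $\alpha,\beta\in\{0,1\}^D$, $\alpha\cdot\beta=\sum_{i=1}^D\alpha[i]\beta[i]$ over the integers. *)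

(* Defs.v *)
From mathcomp Require Import all_boot.

Set Implicit Arguments.
Unset Strict Implicit.
Unset Printing Implicit Defensive.

(* A rooted tree is a parent table: the vertices are 0, ..., tree_size - 1 and, by
   convention, the root is its own parent.  Since every vertex leads to the
   root, this loop is the only cycle. *)
Record rtree := RTree {
  tree_size : nat;
  troot : 'I_tree_size;
  parent : 'I_tree_size -> 'I_tree_size;
  parent_root : parent troot = troot;
  parent_connect : forall v, fconnect parent v troot }.

Definition child (T : rtree) (p c : 'I_(tree_size T)) : bool :=
  (c != troot T) && (parent c == p).

Definition children (T : rtree) (p : 'I_(tree_size T)) : {set 'I_(tree_size T)} :=
  [set c | child p c].

Definition leaf (T : rtree) (v : 'I_(tree_size T)) : bool := children v == set0.

(* findex iterates parent from v until it meets the root, so it counts the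
   edges on the path from the root to v. *)
Definition depth (T : rtree) : nat :=
  \max_(v : 'I_(tree_size T) | leaf v) findex (@parent T) v (troot T).

Definition isomorphic_to_subtree (H G : rtree) : Prop :=
  exists f : 'I_(tree_size H) -> 'I_(tree_size G),
    [/\ injective f, f (troot H) = troot G &
        forall p c : 'I_(tree_size H), child p c -> child (f p) (f c)].

Definition dot (D : nat) (a b : D.-tuple bool) : nat :=
  \sum_(i < D) tnth a i * tnth b i.

(* Model of computation for the running time: structured programs on a
   word RAM.  A program uses finitely many registers and one memory, and every
   operation and memory access costs one unit. *)

Inductive binop := OpAdd | OpSub | OpMul | OpDiv | OpMod | OpLt | OpEq.

Definition op_sem (o : binop) (m n : nat) : nat :=
  match o with
  | OpAdd => m + n
  | OpSub => m - n
  | OpMul => m * n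
  | OpDiv => m %/ n
  | OpMod => m %% n
  | OpLt => m < n
  | OpEq => m == n
  end.

Inductive expr :=
  | Const of nat
  | Reg of nat
  | Fetch of expr
  | Binop of binop & expr & expr.

Inductive prog :=
  | Skip
  | Assign of nat & expr
  | Store of expr & expr
  | Seq of prog & prog
  | If of expr & prog & prog
  | While of expr & prog.

Record state := State { reg : nat -> nat; mem : nat -> nat }.

Fixpoint eval (s : state) (e : expr) : nat :=
  match e with
  | Const n => n
  | Reg x => reg s x
  | Fetch e1 => mem s (eval s e1)
  | Binop o e1 e2 => op_sem o (eval s e1) (eval s e2)
  end.

(* All intermediate values, hence also all addresses, are words in [0, W]. *)
Fixpoint fits (W : nat) (s : state) (e : expr) : bool :=
  (eval s e <= W) &&
  match e with
  | Const _ | Reg _ => true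
  | Fetch e1 => fits W s e1
  | Binop _ e1 e2 => fits W s e1 && fits W s e2
  end.

Fixpoint cost (e : expr) : nat :=
  match e with
  | Const _ | Reg _ => 1
  | Fetch e1 => (cost e1).+1
  | Binop _ e1 e2 => (cost e1 + cost e2).+1
  end.

Definition set_reg (s : state) (x v : nat) : state :=
  State [eta reg s with x |-> v] (mem s).

Definition set_mem (s : state) (a v : nat) : state :=
  State (reg s) [eta mem s with a |-> v].

(* exec W p s t s' : on a machine with words in [0, W], p started in s halts in
   s' after t steps.  A value exceeding W blocks the execution; there is no
   wrap-around, so an execution remains valid when W grows. *)
Inductive exec (W : nat) : prog -> state -> nat -> state -> Prop :=
  | exec_skip s : exec W Skip s 1 s
  | exec_assign s x e :
      fits W s e ->
      exec W (Assign x e) s (cost e).+1 (set_reg s x (eval s e))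
  | exec_store s e1 e2 :
      fits W s e1 -> fits W s e2 ->
      exec W (Store e1 e2) s (cost e1 + cost e2).+1
        (set_mem s (eval s e1) (eval s e2))
  | exec_seq p1 p2 s1 s2 s3 t1 t2 :
      exec W p1 s1 t1 s2 -> exec W p2 s2 t2 s3 ->
      exec W (Seq p1 p2) s1 (t1 + t2) s3
  | exec_if_true e p1 p2 s s' t :
      fits W s e -> eval s e != 0 -> exec W p1 s t s' ->
      exec W (If e p1 p2) s (cost e + t).+1 s'
  | exec_if_false e p1 p2 s s' t :
      fits W s e -> eval s e = 0 -> exec W p2 s t s' ->
      exec W (If e p1 p2) s (cost e + t).+1 s'
  | exec_while_true e p s1 s2 s3 t1 t2 :
      fits W s1 e -> eval s1 e != 0 ->
      exec W p s1 t1 s2 -> exec W (While e p) s2 t2 s3 ->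
      exec W (While e p) s1 (cost e + t1 + t2).+1 s3
  | exec_while_false e p s :
      fits W s e -> eval s e = 0 ->
      exec W (While e p) s (cost e).+1 s.

(* Input: register 0 holds N, register 1 holds D, and bit j of vector i is in
   memory cell i * D + j; everything else is 0. *)
Definition input (N D : nat) (A : N.-tuple (D.-tuple bool)) : state :=
  State (nth 0 [:: N; D])
        (fun k => nth false (flatten [seq tval a | a <- A]) k : nat).

(* Output: register 0 holds the number of vertices, register 1 the address of
   the parent table and register 2 the root. *)
Definition output (s : state) (T : rtree) : Prop :=
  [/\ reg s 0 = tree_size T, reg s 2 = troot T :> nat &
      forall v : 'I_(tree_size T), mem s (reg s 1 + v) = parent v :> nat].

Definition constructs_in_time (W : nat) (P : prog) (N D : nat)
    (A : N.-tuple (D.-tuple bool)) (T : rtree) (tmax : nat) : Prop :=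
  exists t s, [/\ t <= tmax, exec W P (input A) t s & output s T].

(* Main.v *)
Require Import Defs.
From mathcomp Require Import all_boot all_order all_algebra.
From mathcomp Require Import boolp reals exp.
From mathcomp Require Import zify ring lra.

(** Let M be a power of d with N <= M <= d N.  Below each of the M leaves of a
    complete d-ary tree, H has a path of length log_d M and then the gadget of
    some alpha in A, each alpha occurring.  G has the same upper tree, but one of
    its leaves is the root of a second complete d-ary tree, whose leaves carry
    the gadgets of the vectors of B; the other leaves carry a path and the gadget
    of the zero vector, in which every gadget of H embeds.  Level by level, an
    embedding is a bijection on the upper trees, so one leaf of H goes to the
    special leaf of G; its path descends to a leaf of the second tree, and the
    gadget of some alpha has to embed in that of some beta.  Since all leaves of
    the upper tree are equivalent under automorphisms, this is also sufficient.

    A gadget is a binary heap whose leaves are the coordinates, of depth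
    O(log D), with every node expanded so that left and right children cannot
    be swapped and a leaf embeds unless both bits are 1.

    As the vectors of A are distinct, N <= 2^D, so log_d M <= D and the M paths
    have total length O(ND). *)

Set Implicit Arguments.
Unset Strict Implicit.
Unset Printing Implicit Defensive.

(** * The two trees, in coordinates *)

(* [Top l x] and [Sec l x] are the x-th vertices of level l of the upper and of
   the grafted complete d-ary tree, [Path t j] is the t-th vertex of the path
   below the leaf j, and [Gad q c y] is the copy c < 4 of the node y of the
   binary heap (rooted at 0, children 2y+1 and 2y+2) of the gadget q. *)
Inductive vtx :=
  | Top of nat & nat
  | Path of nat & nat
  | Sec of nat & nat
  | Gad of nat & nat & nat.

Section Coordinates.

(* Gadget heaps have L internal nodes, hence L + 1 leaves. *)
Variables d k L : nat.

(* The flag b is false for H and true for G, whose last leaf [Top k (d ^ k).-1]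
   is replaced by [Sec 0 0]. *)
Definition width (b : bool) : nat := d ^ k - b.

(** Gadgets with index below [width b] hang under the paths; in G the next [d ^ k] indices belong to
    the leaves of the grafted tree. Heap leaves have a copy 3 only in G. *)
Definition valid (b : bool) (v : vtx) : bool :=
  match v with
  | Top l x => [&& l <= k, x < d ^ l & (l == k) ==> (x < width b)]
  | Path t j => (t < k) && (j < width b)
  | Sec l x => [&& b, l <= k & x < d ^ l]
  | Gad q c y =>
      [&& q < width b + b * d ^ k, c < 4, y < L.*2.+1 & (c == 3) ==> (b || (y < L))]
  end.

(* At an internal heap node, copy 0 has the children 1 and 2, while 1 has one
   more child than 2: copy 3.  At the leaf of coordinate i, with bit [bt q i],
   H has the path 0 - 1 - 2 or, for bit 1, the children 1 and 2 below 0; G has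
   the path 0 - 1 - 2 and a vertex 3 below 0 or, for bit 1, below 2. *)
Definition vparent (b : bool) (bt : nat -> nat -> bool) (v : vtx) : vtx :=
  match v with
  | Top l x => Top l.-1 (x %/ d)
  | Path 0 j => Top k j
  | Path t.+1 j => Path t j
  | Sec 0 _ => Top k.-1 ((d ^ k).-1 %/ d)
  | Sec l.+1 x => Sec l (x %/ d)
  | Gad q 0 0 => if q < width b then Path k.-1 q else Sec k (q - width b)
  | Gad q 0 y.+1 => Gad q (2 - odd y.+1) y./2
  | Gad q 1 y => Gad q 0 y
  | Gad q 2 y =>
      Gad q (if y < L then 0 else if b then 1 else if bt q (y - L) then 0 else 1) y
  | Gad q _ y => Gad q (if y < L then 1 else if bt q (y - L) then 2 else 0) y
  end.

(** Embeddings in coordinates: a total map, constrained only at valid vertices, with the child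
    relation expressed through parents. *)
Definition vembeds (btH btG : nat -> nat -> bool) : Prop :=
  exists f : vtx -> vtx,
    [/\ forall v, valid false v -> valid true (f v),
        forall u v, valid false u -> valid false v -> f u = f v -> u = v,
        f (Top 0 0) = Top 0 0 &
        forall v, valid false v -> v <> Top 0 0 ->
          vparent true btG (f v) = f (vparent false btH v)].

Hypotheses (d_gt1 : 1 < d) (k_gt0 : 0 < k).

Let d_gt0 : 0 < d. Proof. exact: ltnW. Qed.

Lemma valid_root b : valid b (Top 0 0).
Proof. by rewrite /= eq_sym (gtn_eqF k_gt0). Qed.

Lemma width_le b : width b <= d ^ k.
Proof. exact: leq_subr. Qed.

Lemma expd_gt1 : 1 < d ^ k.
Proof. by rewrite -{1}(exp1n k) ltn_exp2r. Qed.

Lemma valid_vparent b bt v : valid b v -> valid b (vparent b bt v).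
Proof.
have dk : d ^ k = d ^ k.-1 * d by rewrite -expnSr prednK.
case: v => [l x|t j|l x|q c y] /=.
- case/and3P=> hl hx hw; have hl' : l.-1 <= k by lia.
  rewrite hl' /=; case: l hl hx hw hl' => [|l] /= hl hx hw hl'.
    by rewrite (leq_ltn_trans (leq_div _ _) hx) /= eq_sym (gtn_eqF k_gt0).
  by rewrite ltn_divLR // -expnSr hx /= (ltn_eqF hl).
- case/andP=> ht hj; case: t ht => [|t] ht /=; last by rewrite hj (ltnW ht).
  by rewrite leqnn hj implybT (leq_trans hj (width_le b)).
- case/and3P=> hb hl hx; case: l hl hx => [|l] hl hx /=; last first.
    by rewrite hb (ltnW hl) ltn_divLR // -expnSr.
  rewrite leq_pred ltn_divLR // -dk ltn_predL expn_gt0 d_gt0 /=.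
  by rewrite ltn_eqF // ltn_predL.
- case/and4P=> hq hc hy h3.
  case: c hc h3 => [|[|[|[|c]]]] //= _ h3.
  + case: y hy h3 => [|y] hy h3 /=.
      case: ltnP => hqw /=; first by rewrite hqw ltn_predL k_gt0.
      case: b hq hqw {h3} => /= hq hqw; last by lia.
      by rewrite leqnn /=; lia.
    rewrite hq /=; case: (odd y) => /=; lia.
  + by rewrite hq hy.
  + by rewrite hq hy; case: ifP => // _; case: ifP => // _; case: ifP.
  + by rewrite hq hy; case: ifP => // _; case: ifP.
Qed.

(** Adds [c i] modulo [d] to the [i]-th base-[d] digit of [x], most significant first, that is, to
    the branch chosen at level [i] on the way to [x]. Without carries this commutes with taking
    parents, so it is an automorphism of the complete d-ary tree. *)
Fixpoint shift_digits (c : nat -> nat) (l x : nat) : nat :=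
  if l is l'.+1 then shift_digits c l' (x %/ d) * d + (x %% d + c l) %% d else 0.

Lemma shift_digits_lt c l x : shift_digits c l x < d ^ l.
Proof.
elim: l x => [|l IH] x /=; first by rewrite expn0.
rewrite expnSr; have := IH (x %/ d); have := ltn_pmod (x %% d + c l.+1) d_gt0.
by nia.
Qed.

Lemma shift_digits_div c l x : shift_digits c l.+1 x %/ d = shift_digits c l (x %/ d).
Proof. by rewrite /= divnMDl // (divn_small (ltn_pmod _ d_gt0)) addn0. Qed.

Lemma shift_digits_inj c l x y : x < d ^ l -> y < d ^ l -> shift_digits c l x = shift_digits c l y -> x = y.
Proof.
elim: l x y => [|l IH] x y hx hy; first by move: hx hy; rewrite expn0; lia.
move=> e; have /(IH _ _ _ _) : shift_digits c l (x %/ d) = shift_digits c l (y %/ d).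
  by rewrite -!shift_digits_div e.
rewrite !ltn_divLR // -expnSr => /(_ hx hy) ediv.
move: e; rewrite /= ediv => /addnI /eqP; rewrite eqn_modDr !modn_mod => /eqP emod.
by rewrite (divn_eq x d) ediv emod -divn_eq.
Qed.

(* Shifting the base-d digits of j to d - 1 sends the leaf j to the last one. *)
Definition digit_shift (j l : nat) : nat := d.-1 - j %/ d ^ (k - l) %% d.

(** The ancestor of the leaf [j] on level [l] is [j %/ d ^ (k - l)], and the shift turns each of its
    digits into [d.-1]. *)
Lemma shift_digits_anc j l : j < d ^ k -> l <= k ->
  shift_digits (digit_shift j) l (j %/ d ^ (k - l)) = (d ^ l).-1.
Proof.
move=> hj; elim: l => [|l IH] hl //=.
have <- : j %/ d ^ (k - l) = j %/ d ^ (k - l.+1) %/ d.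
  by rewrite -divnMA -expnSr subnSK.
rewrite IH ?(ltnW hl) // /digit_shift.
have hm := ltn_pmod (j %/ d ^ (k - l.+1)) d_gt0.
rewrite subnKC; last by rewrite -ltnS prednK.
rewrite modn_small ?ltn_predL // expnSr.
have : 0 < d ^ l by rewrite expn_gt0 d_gt0.
by move: (d ^ l) => e; nia.
Qed.

Lemma shift_digits_last j : j < d ^ k -> shift_digits (digit_shift j) k j = (d ^ k).-1.
Proof. by move=> hj; rewrite -(shift_digits_anc hj (leqnn k)) subnn expn0 divn1. Qed.

(** By injectivity only [j] is sent to the last leaf, the one that G lacks. *)
Lemma shift_digits_lt_width j x : j < d ^ k -> x < d ^ k -> x != j ->
  shift_digits (digit_shift j) k x < width true.
Proof.
move=> hj hx /eqP neq; have := shift_digits_lt (digit_shift j) k x.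
have : shift_digits (digit_shift j) k x <> (d ^ k).-1.
  by rewrite -(shift_digits_last hj) => /(shift_digits_inj hx hj).
by rewrite /width; lia.
Qed.

Section Embedding.

Variables btH btG : nat -> nat -> bool.
Hypothesis btG0 : forall q i, q < width true -> btG q i = false.

(** * From an orthogonal pair to an embedding *)

Section OrthogonalToEmbedding.

Variables j z : nat.
Hypotheses (jlt : j < d ^ k) (zlt : z < d ^ k).
Hypothesis orth : forall i, i <= L -> ~~ (btH j i && btG (width true + z) i).

Let sh := digit_shift j.

(** At a heap leaf with bit 1, H has copy 2 directly below copy 0. In G that position is taken by
    copy 3, provided that the bit there is 0. *)
Definition gadget_copy (q c y : nat) : nat :=
  if [&& c == 2, L <= y & btH q (y - L)] then 3 else c.

(** The leaf [j] becomes the grafted root, its path descends to the leaf [z] of the grafted tree,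
    and its gadget goes to the one below [z]. Everything else follows the automorphism that moves
    [j] to the last leaf. *)
Definition orth_embed (v : vtx) : vtx :=
  match v with
  | Top l x => if (l == k) && (x == j) then Sec 0 0 else Top l (shift_digits sh l x)
  | Path t x =>
      if x == j then Sec t.+1 (z %/ d ^ (k - t.+1)) else Path t (shift_digits sh k x)
  | Sec l x => Sec l x
  | Gad q c y =>
      Gad (if q == j then width true + z else shift_digits sh k q) (gadget_copy q c y) y
  end.

Lemma gadget_copy_lt q c y : c < 4 -> gadget_copy q c y < 4.
Proof. by rewrite /gadget_copy; case: ifP. Qed.

Lemma width_false : width false = d ^ k. Proof. exact: subn0. Qed.

Lemma orth_embed_valid v : valid false v -> valid true (orth_embed v).
Proof.
case: v => [l x|t x|l x|q c y] //=; rewrite width_false.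
- case/and3P=> hl hx hw; case: ifP => /= [_|]; first by rewrite expn0.
  move/negbT; rewrite negb_and hl shift_digits_lt /= => hne.
  apply/implyP=> /eqP el; move: hne hw hx; rewrite el eqxx /= => hne hx _.
  exact: shift_digits_lt_width.
- case/andP=> ht hx; case: eqVneq => [_|hne] /=; last by rewrite ht shift_digits_lt_width.
  rewrite ht ltn_divLR ?expn_gt0 ?d_gt0 // -expnD subnKC // zlt.
- rewrite mul0n addn0 mul1n => /and4P[hq hc hy h3].
  rewrite gadget_copy_lt // hy /= implybT andbT.
  case: eqVneq => [_|hne]; first by rewrite ltn_add2l.
  by rewrite ltn_addr // shift_digits_lt_width.
Qed.

Lemma orth_embed_inj u v : valid false u -> valid false v ->
  orth_embed u = orth_embed v -> u = v.
Proof.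
(* [gadget_copy] creates a copy 3 only at heap leaves, where H has no copy 3 of its own. *)
have hcopy q q' c c' y y' : valid false (Gad q c y) -> valid false (Gad q' c' y') ->
    q = q' -> gadget_copy q c y = gadget_copy q' c' y' -> y = y' -> c = c'.
  move=> /= /and4P[_ hc _ h3] /and4P[_ hc' _ h3'] <- + ey; rewrite -ey.
  rewrite -ey in h3'; rewrite /gadget_copy.
  case: ifP => [/and3P[/eqP-> hy hb]|_]; case: ifP => [/and3P[/eqP-> hy' hb']|_] //.
    by move=> ec'; move: h3'; rewrite -ec' /=; lia.
  by move=> ec; move: h3; rewrite ec /=; lia.
case: u => [l x|t x|l x|q c y] //; case: v => [l' x'|t' x'|l' x'|q' c' y'] //=;
  rewrite ?width_false.
- case/and3P=> hl hx _ /and3P[hl' hx' _].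
  case: ifP => [/andP[/eqP-> /eqP->]|_]; case: ifP => [/andP[/eqP-> /eqP->]|_] //.
  by case=> el; rewrite -el in hx' *; move/(shift_digits_inj hx hx')->.
- by move=> _ _; do !case: ifP => _.
- by move=> _ _; do !case: ifP => _.
- by move=> _ _; do !case: ifP => _.
- case/andP=> ht hx /andP[ht' hx'].
  case: eqP => [->|_]; case: eqP => [->|_] //; first by case=> ->.
  by case=> -> /(shift_digits_inj hx hx')->.
- by move=> _ _; do !case: ifP => _.
- by move=> _ _; do !case: ifP => _.
- by move=> _ _; do !case: ifP => _.
- move=> hu hv [eq0 ec ey].
  move: (hu) (hv); rewrite mul0n addn0 => /and4P[hq _ _ _] /and4P[hq' _ _ _].
  (* The gadget of [j] lands at an index at least [width true], all the others below it. *)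
  have eqq : q = q'.
    move: eq0; case: eqVneq => [->|ne]; case: eqVneq => [->|ne'] //.
    + by move=> e; have := shift_digits_lt_width jlt hq' ne'; rewrite -/sh -e; lia.
    + by move=> e; have := shift_digits_lt_width jlt hq ne; rewrite -/sh e; lia.
    + exact: shift_digits_inj.
  suff -> : c = c' by rewrite eqq ey.
  by apply: (@hcopy q q' c c' y y'); rewrite //= width_false.
Qed.

Lemma orth_embed_parent v : valid false v -> v <> Top 0 0 ->
  vparent true btG (orth_embed v) = orth_embed (vparent false btH v).
Proof.
case: v => [l x|t x|l x|q c y] //.
- move=> /= /and3P[hl hx _]; case: l hl hx => [|l] hl hx.
    by move: hx; rewrite expn0; case: x.
  move=> _ /=; rewrite (ltn_eqF hl) /=; case: ifP => [/andP[/eqP el /eqP ex]|_] /=.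
    (* The grafted root hangs where the last leaf would be, and that leaf is the shift of [j]. *)
    congr Top; first by rewrite -el.
    by rewrite -(shift_digits_last jlt) -el shift_digits_div ex.
  by rewrite shift_digits_div.
- move=> /= /andP[ht hx] _; case: t ht => [|t] ht /=.
    case: eqVneq => [->|ne] /=; last by rewrite eqxx.
    by rewrite !eqxx /= divn_small // ltn_divLR ?expn_gt0 ?d_gt0 //
        mulnC -expnSr subn1 prednK.
  case: eqVneq => // _ /=.
  by rewrite -divnMA -expnSr subnSK.
- move=> /=; rewrite width_false mul0n addn0 => /and4P[hq hc hy h3] _.
  have hqw : q != j -> shift_digits sh k q < width true by exact: shift_digits_lt_width.
  (* Orthogonality enters here: a bit 1 in H always meets a bit 0 in the target gadget, which is
     either that of [z] or that of the zero vector. *)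
  have hbt i : i <= L -> btH q i ->
      btG (if q == j then width true + z else shift_digits sh k q) i = false.
    move=> hi hb; case: eqVneq => [eq0|/hqw/btG0->//].
    by move: (orth hi); rewrite -eq0 hb /= => /negbTE.
  case: c hc h3 => [|[|[|[|c]]]] //= _ h3.
  + case: y hy h3 hbt => [|y] hy h3 hbt /=.
      rewrite hq; case: eqVneq => [->|ne] /=.
        by rewrite ltnNge leq_addr /= addKn eqxx prednK // subnn expn0 divn1.
      by rewrite (hqw ne) (negbTE ne).
    by rewrite /gadget_copy [L <= y./2]leqNgt (_ : y./2 < L) ?andbF //; lia.
  + rewrite /gadget_copy /=.
    case: (ltnP y L) => hyL /=; first by [].
    by case hb: (btH q (y - L)); rewrite //= ?ltnNge ?hyL /= ?hbt //; lia.
  + by rewrite /gadget_copy /= h3.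
Qed.

End OrthogonalToEmbedding.

(** * From an embedding to an orthogonal pair *)

Section EmbeddingToOrthogonal.

Variable f : vtx -> vtx.
Hypothesis f_valid : forall v, valid false v -> valid true (f v).
Hypothesis f_inj :
  forall u v, valid false u -> valid false v -> f u = f v -> u = v.
Hypothesis f_root : f (Top 0 0) = Top 0 0.
Hypothesis f_parent : forall v, valid false v -> v <> Top 0 0 ->
  vparent true btG (f v) = f (vparent false btH v).

Lemma embed_nonroot v : valid false v -> v <> Top 0 0 -> f v <> Top 0 0.
Proof.
by move=> hv hne; rewrite -f_root => /(f_inj hv (valid_root false)).
Qed.

(** Levels are preserved, by induction from the root: in G the children of an upper vertex of level
    below [k] are upper vertices of the next level or the grafted root, which replaces a leaf. *)
Lemma embed_Top l x : valid false (Top l x) ->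
  (exists2 x', f (Top l x) = Top l x' & (l == k) ==> (x' < width true))
  \/ l = k /\ f (Top l x) = Sec 0 0.
Proof.
elim: l x => [|l IH] x hv.
  have -> : x = 0 by case/and3P: hv => _; rewrite expn0; case: x.
  by left; exists 0; rewrite // eq_sym (gtn_eqF k_gt0).
have hl : l < k by case/and3P: hv.
have hne : Top l.+1 x <> Top 0 0 by [].
have [[x' ex' _]|[el _]] := IH _ (valid_vparent btH hv); last by lia.
have := f_parent hv hne; rewrite /= ex'.
(* [vparent] fixes the root, so the root has to be excluded separately as an image. *)
have := f_valid hv; have := embed_nonroot hv hne.
case: (f _) => [m y|[|t] y|[|m] y|q [|[|[|c]]] [|y]] //=.
- case: m => [|m] /=; first by rewrite expn0; case: y => [|y] // _; rewrite andbF.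
  by move=> _ /and3P[_ _ hw] [<-]; left; exists y.
- by move=> _ _ [e]; move: hl; rewrite e ltnn.
- rewrite expn0 => _; case: y => // _ [e _]; right.
  by rewrite -e prednK.
- by case: ifP.
Qed.

(** Pigeonhole: H has [d ^ k] leaves in its upper tree, G only [d ^ k - 1] besides the grafted
    root. *)
Lemma embed_last : exists2 j, j < d ^ k & f (Top k j) = Sec 0 0.
Proof.
have hvT j : j < d ^ k -> valid false (Top k j).
  by move=> hj; rewrite /= width_false leqnn hj implybT.
pose index v := if v is Top _ x then x else 0.
pose grafted v := if v is Sec _ _ then true else false.
case hg: (has (fun j => grafted (f (Top k j))) (iota 0 (d ^ k))).
  have [j] := hasP hg; rewrite mem_iota add0n => hj.
  by case: (embed_Top (hvT j hj)) => [[x' -> _]|[_ ej _]] //; exists j.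
have hT j : j < d ^ k -> exists2 x', f (Top k j) = Top k x' & x' < width true.
  move=> hj; case: (embed_Top (hvT j hj)) => [[x' e]|[_ e]].
    by rewrite eqxx; exists x'.
  by case/negP: hg; apply/hasP; exists j; rewrite ?mem_iota ?e.
have hu : uniq [seq index (f (Top k j)) | j <- iota 0 (d ^ k)].
  rewrite map_inj_in_uniq ?iota_uniq // => i j; rewrite !mem_iota !add0n.
  move=> hi hj; case: (hT i hi) => x ex _; case: (hT j hj) => y ey _.
  rewrite ex ey /= => exy; have : Top k i = Top k j.
    by apply: f_inj; rewrite ?ex ?ey ?exy //; apply: hvT.
  by case.
have : {subset [seq index (f (Top k j)) | j <- iota 0 (d ^ k)]
        <= iota 0 (width true)}.
  move=> x /mapP[j]; rewrite !mem_iota !add0n => hj ->.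
  by case: (hT j hj) => y ->.
move/(uniq_leq_size hu); rewrite size_map !size_iota.
by have := expd_gt1; rewrite /width; lia.
Qed.

(** Above level [k], the grafted tree offers only its own next level as children, so the path has to
    descend in it. *)
Lemma embed_Path j t : j < d ^ k -> f (Top k j) = Sec 0 0 -> t < k ->
  exists x, f (Path t j) = Sec t.+1 x.
Proof.
move=> hj ej ht.
have hv : valid false (Path t j) by rewrite /= ht width_false.
have [x ex] : exists x, f (vparent false btH (Path t j)) = Sec t x.
  elim: t ht {hv} => [|t IH] ht; first by exists 0.
  have hv : valid false (Path t j) by rewrite /= (ltnW ht) width_false.
  have [x ex] := IH (ltnW ht); have := f_parent hv; rewrite ex => /(_ ltac:(by [])).
  rewrite [vparent false _ _]/=; have := f_valid hv.
  case: (f (Path t j)) => [m y|[|t'] y|[|m] y|q [|[|[|c]]] [|y]] //=.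
  + by move=> _ [<-]; exists y.
  + by case: ifP => // _ _ [e]; move: ht; rewrite e; lia.
have := f_parent hv; rewrite ex => /(_ ltac:(by [])).
case: (f (Path t j)) => [m y|[|t'] y|[|m] y|q [|[|[|c]]] [|y]] //=.
+ by case=> <-; exists y.
+ by case: ifP => // _ [e]; move: ht; rewrite e ltnn.
Qed.

(** The end of the path sits at a leaf [z] of the grafted tree, whose only child is the root of its
    gadget. *)
Lemma embed_gadget_root j : j < d ^ k -> f (Top k j) = Sec 0 0 ->
  exists2 z, z < d ^ k & f (Gad j 0 0) = Gad (width true + z) 0 0.
Proof.
move=> hj ej; have hk : k.-1 < k by rewrite prednK.
have [x ex] := embed_Path hj ej hk.
have hv : valid false (Gad j 0 0) by rewrite /= width_false ltn_addr.
have := f_parent hv (ltac:(by [])).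
have -> : vparent false btH (Gad j 0 0) = Path k.-1 j by rewrite /= width_false hj.
rewrite ex prednK //; have := f_valid hv.
case: (f (Gad j 0 0)) => [m y|[|t'] y|[|m] y|q [|[|[|c]]] [|y]] //=.
- by case/andP=> + _ [em]; rewrite em ltnn.
- case: (ltnP q (width true)) => // hq /andP[hlt _] [ex']; exists (q - width true); first by lia.
  by rewrite subnKC.
Qed.

(** Inverts [vparent] inside a gadget of G, listing the possible images of a child. *)
Lemma gadget_child q c y u : valid true u -> vparent true btG u = Gad q c y ->
  [\/ exists2 y', u = Gad q 0 y' & [/\ 0 < y', c = 2 - odd y' & y = y'.-1./2],
      u = Gad q 1 y /\ c = 0,
      u = Gad q 2 y /\ c = (if y < L then 0 else 1) |
      u = Gad q 3 y /\
      c = (if y < L then 1 else if btG q (y - L) then 2 else 0)].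
Proof.
case: u => [m y'|[|t'] y'|[|m] y'|q' [|[|[|[|c']]]] y'] //=.
- case: y' => [|y'] _; first by case: ifP.
  by case=> <- <- <-; constructor 1; exists y'.+1.
- by move=> _ [-> <- ->]; constructor 2.
- by move=> _ [-> <- ->]; constructor 3.
- by move=> _ [-> <- ->]; constructor 4.
- by rewrite andbF.
Qed.

(** * Rigidity of the gadgets *)

Section Gadget.

Variables j q : nat.
Hypotheses (jlt : j < d ^ k) (fj : f (Gad j 0 0) = Gad q 0 0).

Lemma valid_gadget c y : c < 4 -> y < L.*2.+1 -> (c == 3) ==> (y < L) ->
  valid false (Gad j c y).
Proof. by move=> /= -> -> ->; rewrite width_false ltn_addr. Qed.

Lemma embed_gadget_child c y c' y' v : c < 4 -> y < L.*2.+1 ->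
  (c == 3) ==> (y < L) ->
  vparent false btH (Gad j c y) = v -> f v = Gad q c' y' ->
  [\/ exists2 y'', f (Gad j c y) = Gad q 0 y'' &
        [/\ 0 < y'', c' = 2 - odd y'' & y' = y''.-1./2],
      f (Gad j c y) = Gad q 1 y' /\ c' = 0,
      f (Gad j c y) = Gad q 2 y' /\ c' = (if y' < L then 0 else 1) |
      f (Gad j c y) = Gad q 3 y' /\
      c' = (if y' < L then 1 else if btG q (y' - L) then 2 else 0)].
Proof.
move=> hc hy h3 ev efv; have hv := valid_gadget hc hy h3.
by apply: gadget_child; rewrite ?f_valid // f_parent // ev.
Qed.

(** Copies 1 and 2 go to copies 1 and 2 in some order. A swap would send both children of copy 1,
    namely copy 3 and the left heap child, to the single child of copy 2. *)
Lemma embed_gadget_internal y : y < L -> f (Gad j 0 y) = Gad q 0 y ->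
  f (Gad j 1 y) = Gad q 1 y /\ f (Gad j 2 y) = Gad q 2 y.
Proof.
move=> hy ey; have hyK : y < L.*2.+1 by lia.
have hy1 : y.*2.+1 < L.*2.+1 by lia.
have v1 : valid false (Gad j 1 y) by apply: valid_gadget.
have v2 : valid false (Gad j 2 y) by apply: valid_gadget.
have c12 : f (Gad j 1 y) <> f (Gad j 2 y) by move/(f_inj v1 v2).
have hchild c : c = 1 \/ c = 2 ->
    f (Gad j c y) = Gad q 1 y \/ f (Gad j c y) = Gad q 2 y.
  move=> hc; case: (@embed_gadget_child c y 0 y (Gad j 0 y)) => //;
    try by case: hc => ->.
  - by case: hc => -> //=; rewrite hy.
  - by case=> y' _ [h]; case: odd.
  - by case; left.
  - by case; right.
  - by case=> _; rewrite hy.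
case: (hchild 1) => [|e1|e1]; first by left.
  by case: (hchild 2) => [|e2|e2]; [right|move: c12; rewrite e1 e2|].
have only c y' : c < 4 -> y' < L.*2.+1 -> (c == 3) ==> (y' < L) ->
    vparent false btH (Gad j c y') = Gad j 1 y ->
    f (Gad j c y') = Gad q 0 y.*2.+2.
  move=> hc hy' h3 hp.
  case: (embed_gadget_child hc hy' h3 hp e1) => [[y2 -> [h2 ho hy2]]||| ];
    rewrite ?hy; try by case.
  by congr Gad; lia.
have e3 := @only 3 y isT hyK hy; have e0 := @only 0 y.*2.+1 isT hy1 isT.
have : f (Gad j 3 y) = f (Gad j 0 y.*2.+1).
  by rewrite e3 ?e0 //= ?hy ?doubleK //= odd_double.
by move/f_inj => /(_ (@valid_gadget 3 y isT hyK hy) (@valid_gadget 0 _ isT hy1 isT)).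
Qed.

Lemma embed_gadget y : y < L.*2.+1 -> f (Gad j 0 y) = Gad q 0 y.
Proof.
elim/ltn_ind: y => y IH hy; case: (posnP y) => [->//|y_gt0].
have hz : y.-1./2 < L by lia.
have hzy : y.-1./2 < y by lia.
have [e1 e2] := embed_gadget_internal hz (IH _ hzy ltac:(lia)).
have hp : vparent false btH (Gad j 0 y) = Gad j (2 - odd y) y.-1./2.
  by case: y y_gt0 {IH hy hz hzy e1 e2}.
have e : f (Gad j (2 - odd y) y.-1./2) = Gad q (2 - odd y) y.-1./2.
  by case: (odd y); [exact: e1|exact: e2].
case: (@embed_gadget_child 0 y _ _ _ isT hy isT hp e) => [[y' -> [y'_gt0 ho hh]]|[_]|[_]|[e3 _]].
- by congr Gad; lia.
- by case: odd.
- by rewrite hz; case: odd.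
(* The remaining candidate is copy 3 of the heap parent; it has no children, whereas copy 0 of [y]
   has copy 1 below it. *)
- have hp1 : vparent false btH (Gad j 1 y) = Gad j 0 y by [].
  case: (@embed_gadget_child 1 y _ _ _ isT hy isT hp1 e3) => [[? _ [_]]|[_]|[_]|[_]] //.
  + by case: odd.
  + by case: ifP.
  + by do !case: ifP => _.
Qed.

(** Coordinate [i] sits at the heap leaf [L + i]. If both bits were 1, copy 0 would have two
    children in H but only copy 1 below it in G. *)
Lemma embed_gadget_orth i : i <= L -> ~~ (btH j i && btG q i).
Proof.
move=> hi; apply/negP => /andP[bH bG].
have hy : L + i < L.*2.+1 by lia.
have hL : (L + i < L) = false by lia.
have only c : 0 < c < 3 -> f (Gad j c (L + i)) = Gad q 1 (L + i).
  move=> hc; have hp : vparent false btH (Gad j c (L + i)) = Gad j 0 (L + i).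
    by case: c hc => [|[|[|c]]] //= _; rewrite hL addKn bH.
  have [hc4 h3] : c < 4 /\ (c == 3) ==> (L + i < L).
    by case: c hc {hp} => [|[|[|c]]].
  case: (embed_gadget_child hc4 hy h3 hp (embed_gadget hy)).
  - by case=> y' _ [_]; case: odd.
  - by case.
  - by rewrite hL => -[].
  - by rewrite hL addKn bG => -[].
have := f_inj (@valid_gadget 1 _ isT hy isT) (@valid_gadget 2 _ isT hy isT).
by rewrite !only // => /(_ erefl).
Qed.

End Gadget.
End EmbeddingToOrthogonal.

Lemma vembeds_orthogonal : vembeds btH btG <->
  exists j z, [/\ j < d ^ k, z < d ^ k &
    forall i, i <= L -> ~~ (btH j i && btG (width true + z) i)].
Proof.
split=> [[f [f_valid f_inj f_root f_parent]]|[j [z [jlt zlt orth]]]].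
  have [j jlt ej] := embed_last f_valid f_inj f_root f_parent.
  have [z zlt ez] := embed_gadget_root f_valid f_parent jlt ej.
  exists j, z; split=> // i.
  exact: embed_gadget_orth f_valid f_inj f_parent _ _ jlt ez i.
exists (orth_embed j z); split.
- exact: orth_embed_valid.
- exact: orth_embed_inj.
- by rewrite /= eq_sym (gtn_eqF k_gt0).
- exact: orth_embed_parent.
Qed.

End Embedding.
End Coordinates.

(** * Numbering of the vertices *)

Lemma findex_iter_le (T : finType) (f : T -> T) (x : T) n : findex f x (iter n f x) <= n.
Proof.
have [hn|hn] := ltnP n (order f x); first by rewrite findex_iter.
apply: leq_trans hn; apply: ltnW; rewrite findex_max //; exact: fconnect_iter.
Qed.

Section Numbering.

Variables d k L : nat.

(** The number of vertices on the levels below [l], that is [1 + d + ... + d ^ (l - 1)]. The Horner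
    form makes [(v - 1) %/ d] the parent of [v] in level order. *)
Fixpoint heap_size (l : nat) : nat :=
  if l is l'.+1 then heap_size l' * d + 1 else 0.

(** The upper leaves are row 0 and the path vertices rows 1 to [k], all of length [width], so the
    parent of a path vertex lies [width] places earlier. *)
Definition grafted_base (b : bool) : nat := heap_size k + k.+1 * width d k b.

Definition gadget_base (b : bool) : nat :=
  grafted_base b + b * (heap_size k + d ^ k).

(** Copy 3 is stored last, so that in H the block just stops after the [L] internal nodes. *)
Definition gadget_size (b : bool) : nat := 3 * L.*2.+1 + (if b then L.*2.+1 else L).

Definition num_vertices (b : bool) : nat :=
  gadget_base b + (width d k b + b * d ^ k) * gadget_size b.

Definition enc (b : bool) (v : vtx) : nat :=
  match v with
  | Top l x => heap_size l + x
  | Path t j => heap_size k + t.+1 * width d k b + j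
  | Sec l x => grafted_base b + (heap_size l + x)
  | Gad q c y => gadget_base b + (q * gadget_size b + (c * L.*2.+1 + y))
  end.

Definition copy_parent (b bit : bool) (c y : nat) : nat :=
  if c == 0 then 2 - y %% 2
  else if c == 1 then 0
  else if c == 2 then (if y < L then 0 else if b then 1 else if bit then 0 else 1)
  else if y < L then 1 else if bit then 2 else 0.

(** [vparent] in the arithmetic form that the program evaluates. Truncated subtraction makes the
    root 0 its own parent. *)
Definition nparent (b : bool) (bt : nat -> nat -> bool) (v : nat) : nat :=
  if v < heap_size k + width d k b then (v - 1) %/ d
  else if v < grafted_base b then v - width d k b
  else if v < gadget_base b then
    if v == grafted_base b then (heap_size k + d ^ k - 2) %/ d
    else grafted_base b + (v - grafted_base b - 1) %/ d
  else
    let q := (v - gadget_base b) %/ gadget_size b in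
    let g := (v - gadget_base b) %% gadget_size b in
    let c := g %/ L.*2.+1 in
    let y := g %% L.*2.+1 in
    if g == 0 then
      heap_size k + k * width d k b + q + (if q < width d k b then 0 else heap_size k)
    else v - g + copy_parent b (bt q (y - L)) c y * L.*2.+1
         + (if c == 0 then (y - 1) %/ 2 else y).

Lemma heap_sizeS l : heap_size l.+1 = heap_size l + d ^ l.
Proof.
have e m : heap_size m.+1 = heap_size m * d + 1 by [].
by elim: l => // l IH; rewrite e {1}IH e expnSr; lia.
Qed.

Lemma heap_size_mono : {homo heap_size : l m / l <= m}.
Proof.
by apply: homo_leq => // [|l]; [exact: leq_trans|rewrite heap_sizeS leq_addr].
Qed.

Lemma heap_size_lt l m x : l < m -> x < d ^ l -> heap_size l + x < heap_size m.
Proof. by move=> /heap_size_mono; rewrite heap_sizeS; lia. Qed.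

Lemma heap_index_inj l x m y : x < d ^ l -> y < d ^ m ->
  heap_size l + x = heap_size m + y -> l = m /\ x = y.
Proof.
move=> hx hy e; case: (ltngtP l m) => hlm.
- by have := heap_size_lt hlm hx; lia.
- by have := heap_size_lt hlm hy; lia.
- by split=> //; move: e; rewrite hlm; lia.
Qed.

Lemma heap_index_surj m v : v < heap_size m ->
  exists l x, [/\ l < m, x < d ^ l & v = heap_size l + x].
Proof.
elim: m => [|m IH] // hv; case: (ltnP v (heap_size m)) => [/IH|hm].
  by case=> l [x [hl hx e]]; exists l, x; split=> //; apply: ltnW.
by exists m, (v - heap_size m); split; move: hv; rewrite // heap_sizeS; lia.
Qed.

Hypothesis d_gt1 : 1 < d.

Let d_gt0 : 0 < d. Proof. exact: ltnW. Qed.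

Lemma heap_parent l x : (heap_size l.+1 + x - 1) %/ d = heap_size l + x %/ d.
Proof. by rewrite /= addnAC addnK divnMDl. Qed.

Lemma heap_size_le l : heap_size l <= d ^ l.
Proof.
(* The strict inequality passes through the induction, as [d] is at least 2. *)
suff : heap_size l < d ^ l by exact: ltnW.
elim: l => [|l IH]; rewrite ?expn0 // [heap_size _]/= expnSr.
by move: (d ^ l) IH => e IH; nia.
Qed.

Hypothesis k_gt0 : 0 < k.

Lemma gadget_size_gt0 b : 0 < gadget_size b.
Proof. by rewrite /gadget_size mulnS ltn_addr. Qed.

Lemma gadget_index_lt b c y : c < 4 -> y < L.*2.+1 -> (c == 3) ==> (b || (y < L)) ->
  c * L.*2.+1 + y < gadget_size b.
Proof. by case: c => [|[|[|[|c]]]] // _ hy; rewrite /gadget_size; case: b; lia. Qed.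

Lemma heap_size_gt0 : 0 < heap_size k.
Proof. by rewrite -(prednK k_gt0) /= addn1. Qed.

Lemma enc_range b v : valid d k L b v ->
  match v with
  | Top _ _ => enc b v < heap_size k + width d k b
  | Path _ _ => heap_size k + width d k b <= enc b v < grafted_base b
  | Sec _ _ => b && (grafted_base b <= enc b v < gadget_base b)
  | Gad _ _ _ => gadget_base b <= enc b v < num_vertices b
  end.
Proof.
case: v => [l x|t j|l x|q c y] /=.
- case/and3P=> hl hx hw; case: (ltnP l k) => hlk.
    by rewrite (leq_trans (heap_size_lt hlk hx)) // leq_addr.
  have el : l = k by lia.
  by move: hw; rewrite el eqxx /= ltn_add2l.
- case/andP=> ht hj; rewrite /grafted_base mulSn.
  have : t.+1 * width d k b <= k * width d k b by rewrite leq_mul2r ht orbT.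
  by rewrite !mulSn; lia.
- case: b => //= /andP[hl hx]; rewrite leq_addr /gadget_base mul1n ltn_add2l.
  by rewrite -heap_sizeS heap_size_lt.
- case/and4P=> hq hc hy h3; rewrite leq_addr ltn_add2l /=.
  apply: (@leq_trans (q.+1 * gadget_size b)); last by rewrite leq_mul2r hq orbT.
  by rewrite mulSn addnC ltn_add2r gadget_index_lt.
Qed.

Lemma grafted_base_ge b : heap_size k + width d k b <= grafted_base b.
Proof. by rewrite /grafted_base mulSn; lia. Qed.

Lemma gadget_base_ge b : grafted_base b <= gadget_base b.
Proof. exact: leq_addr. Qed.

Lemma num_vertices_ge b : gadget_base b <= num_vertices b.
Proof. exact: leq_addr. Qed.

Lemma enc_lt b v : valid d k L b v -> enc b v < num_vertices b.
Proof.
move/enc_range; have := (grafted_base_ge b, gadget_base_ge b, num_vertices_ge b).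
by move=> [[]]; case: v => [l x|t j|l x|q c y] *; lia.
Qed.

Lemma row_index_inj w i j i' j' : j < w -> j' < w ->
  i * w + j = i' * w + j' -> i = i' /\ j = j'.
Proof.
move=> hj hj' e; have w_gt0 := leq_ltn_trans (leq0n _) hj.
have ei : i = i'.
  move: (congr1 (fun n => n %/ w) e).
  by rewrite /= !divnMDl // !divn_small // !addn0.
by split=> //; move: e; rewrite ei => /addnI.
Qed.

Lemma enc_inj b u v : valid d k L b u -> valid d k L b v ->
  enc b u = enc b v -> u = v.
Proof.
move=> hu hv; have := (enc_range hu, enc_range hv).
have := (grafted_base_ge b, gadget_base_ge b).
case: u hu => [l x|t j|l x|q c y]; case: v hv => [l' x'|t' j'|l' x'|q' c' y'];
  move=> hv hu [hg1 hg2] [ru rv] e; try by [lia].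
- by case/and3P: hu hv => _ hx _ /and3P[_ hx' _]; case: (heap_index_inj hx hx' e) => -> ->.
- case/andP: hu hv => _ hj /andP[_ hj'].
  have {}e : t.+1 * width d k b + j = t'.+1 * width d k b + j'.
    by move: e; rewrite /enc; lia.
  by case: (row_index_inj hj hj' e) => -[->] ->.
- move: e => /= /addnI e.
  case/and3P: hu hv => _ _ hx /and3P[_ _ hx'].
  by case: (heap_index_inj hx hx' e) => -> ->.
- move: e => /= /addnI e.
  case/and4P: hu hv => _ hc hy h3 /and4P[_ hc' hy' h3'].
  case: (row_index_inj (gadget_index_lt hc hy h3) (gadget_index_lt hc' hy' h3') e).
  by move=> -> /(row_index_inj hy hy')[-> ->].
Qed.

Lemma enc_surj b v : v < num_vertices b -> exists2 u, valid d k L b u & enc b u = v.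
Proof.
move=> hv; case: (ltnP v (heap_size k + width d k b)) => h1.
  have [l [x [hl hx e]]] : exists l x, [/\ l < k.+1, x < d ^ l & v = heap_size l + x].
    apply: heap_index_surj; rewrite heap_sizeS.
    by apply: leq_trans h1 _; rewrite leq_add2l leq_subr.
  exists (Top l x) => //=; rewrite -ltnS hl hx /=.
  by apply/implyP=> /eqP el; move: h1; rewrite e el ltn_add2l.
case: (ltnP v (grafted_base b)) => h2.
  have w_gt0 : 0 < width d k b.
    by case: (posnP (width d k b)) h1 h2 => [e|//]; rewrite /grafted_base e; lia.
  pose r := v - (heap_size k + width d k b).
  exists (Path (r %/ width d k b) (r %% width d k b)) => /=.
    rewrite ltn_mod w_gt0 andbT ltn_divLR // /r.
    by move: h1 h2; rewrite /grafted_base mulSn; lia.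
  by have := divn_eq r (width d k b); rewrite mulSn /r; lia.
case: (ltnP v (gadget_base b)) => h3.
  case: b h1 h2 h3 {hv} => h1 h2 h3; last by move: h2 h3; rewrite /gadget_base; lia.
  have [l [x [hl hx e]]] : exists l x,
      [/\ l < k.+1, x < d ^ l & v - grafted_base true = heap_size l + x].
    by apply: heap_index_surj; rewrite heap_sizeS; move: h3; rewrite /gadget_base; lia.
  by exists (Sec l x); rewrite /= -?e ?subnKC // -ltnS hl hx.
pose r := v - gadget_base b.
have P_gt0 := gadget_size_gt0 b.
have hg := ltn_pmod r P_gt0.
exists (Gad (r %/ gadget_size b) (r %% gadget_size b %/ L.*2.+1)
            (r %% gadget_size b %% L.*2.+1)) => /=; last first.
  by rewrite -divn_eq -divn_eq /r subnKC.
rewrite ltn_divLR // ltn_mod /=; apply/and3P; split.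
- by move: hv; rewrite /num_vertices /r; lia.
- rewrite ltn_divLR //; apply: leq_trans hg _; rewrite /gadget_size.
  by case: (b); lia.
- apply/implyP=> /eqP e3; case: (b) hg e3 => //= hg e3.
  have := divn_eq (r %% gadget_size false) L.*2.+1; rewrite e3.
  by move: hg; rewrite {2}/gadget_size; lia.
Qed.

Lemma nparent_enc b bt v : valid d k L b v ->
  nparent b bt (enc b v) = enc b (vparent d k L b bt v).
Proof.
move=> hv; have := enc_range hv; have h1 := grafted_base_ge b.
have h2 := gadget_base_ge b; have hX := heap_size_gt0.
rewrite /nparent; case: v hv => [l x|t j|l x|q c y] hv.
- move=> ->; case: l hv => [|l] hv; last by rewrite heap_parent.
  by case/and3P: hv => _; rewrite expn0; case: x => // _ _; rewrite /= !div0n.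
- case/andP=> ha hb; rewrite ltnNge ha hb /=.
  by case: t hv {ha hb} => [|t] /andP[ht hj] /=; rewrite ?mulSn; lia.
- case/and3P=> eb ha hb; rewrite ltnNge (leq_trans h1 ha) /= ltnNge ha /= hb.
  case: l hv {ha hb} => [|l] /and3P[_ hl hx] /=.
    have -> : x = 0 by move: hx; rewrite expn0; case: (x).
    rewrite addn0 addn0 eqxx.
    (* The missing last leaf would have number [heap_size k + d ^ k - 1]; the grafted root has its
       parent. *)
    have := heap_parent k.-1 (d ^ k).-1; rewrite prednK // => <-.
    have : 0 < d ^ k by rewrite expn_gt0 d_gt0.
    by move=> ?; congr (_ %/ _); lia.
  rewrite ifN; last by apply/eqP; lia.
  by rewrite addKn heap_parent.
- case/andP=> ha _; rewrite ltnNge (leq_trans h1 (leq_trans h2 ha)) /=.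
  rewrite ltnNge (leq_trans h2 ha) /= ltnNge ha /= addKn.
  case/and4P: hv => hq hc hy h3; have hP := gadget_index_lt hc hy h3.
  rewrite divnMDl ?gadget_size_gt0 // (divn_small hP) addn0 modnMDl (modn_small hP).
  rewrite divnMDl // (divn_small hy) addn0 modnMDl (modn_small hy).
  have -> m n : m + (n + (c * L.*2.+1 + y)) - (c * L.*2.+1 + y) = m + n.
    by rewrite addnA addnK.
  rewrite /copy_parent modn2.
  case: c hc h3 hP {ha} => [|[|[|[|c]]]] //= hc h3 hP.
  + case: y hy h3 hP => [|y] hy h3 hP /=.
      case: ltnP => hqw /=; first by rewrite prednK; lia.
      (* The grafted tree starts one row after the last path row, which cancels the [width] in
         [q - width]; only the offset [heap_size k] of its leaves remains. *)
      by rewrite /grafted_base mulSn; lia.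
    by rewrite subn1 divn2 !addnA.
  + by rewrite -!addnA.
  + by rewrite -!addnA.
  + by rewrite -!addnA.
Qed.

Lemma nparent_lt b bt v : v < num_vertices b -> nparent b bt v < num_vertices b.
Proof.
by case/enc_surj=> u hu <-; rewrite nparent_enc // enc_lt // valid_vparent.
Qed.

Lemma num_vertices_gt0 b : 0 < num_vertices b.
Proof. by have := enc_lt (valid_root d L k_gt0 b). Qed.

(** An upper bound for the depth that drops strictly towards the root. Each level of the binary
    heap, [trunc_log 2 y.+1] for the node [y], counts 3. *)
Definition rank (v : vtx) : nat :=
  match v with
  | Top l _ => l
  | Path t _ => k.+1 + t
  | Sec l _ => k + l
  | Gad _ c y => k.*2.+1 + 3 * trunc_log 2 y.+1 + c
  end.

Lemma rank_vparent b bt v : valid d k L b v -> v <> Top 0 0 ->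
  rank (vparent d k L b bt v) < rank v.
Proof.
case: v => [l x|t j|l x|q c y] //=.
- by case: l => [|l] //; rewrite expn0; case: x => // x /and3P[].
- by case: t => [|t] /=; lia.
- by case: l => [|l] /= _ _; lia.
- case/and4P=> _ hc hy h3 _; case: c hc h3 => [|[|[|[|c]]]] //= _ h3; try by lia.
  + case: y hy h3 => [|y] hy _ /=; first by case: ifP => _ /=; lia.
    rewrite (@trunc_log2S y.+2) // -[y.+2./2]/(y./2.+1).
    by case: (odd y); lia.
  + by do !case: ifP => _; lia.
  + by do !case: ifP => _; lia.
Qed.

Lemma rank_le b v : valid d k L b v -> rank v <= k.*2 + 3 * trunc_log 2 L.+1 + 7.
Proof.
case: v => [l x|t j|l x|q c y] //=.
- by case/and3P=> *; lia.
- by case/andP=> *; lia.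
- by case/and3P=> *; lia.
- case/and4P=> _ hc hy _.
  (* The 7 is 1 from the offset [k.*2.+1], 3 from the extra heap level, and 3 from the copy
     number. *)
  have : trunc_log 2 y.+1 <= trunc_log 2 L.+1.*2 by apply: leq_trunc_log; lia.
  by rewrite (@trunc_log2S L.+1.*2) ?doubleK //; lia.
Qed.

(** A number below [d] that tells siblings apart, with [nth_child] as inverse. The grafted root has
    the index of the last leaf, whose final digit is [d.-1]. *)
Definition sibling_index (v : vtx) : nat :=
  match v with
  | Top _ x => x %% d
  | Path _ _ => 0
  | Sec 0 _ => d.-1
  | Sec _.+1 x => x %% d
  | Gad _ c _ => 1 < c
  end.

Lemma sibling_index_lt v : sibling_index v < d.
Proof.
case: v => [l x|t j|[|l] x|q c y] /=; rewrite ?ltn_pmod ?ltn_predL //.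
by case: (1 < c); lia.
Qed.

Definition nth_child (b : bool) (p : vtx) (i : nat) : vtx :=
  match p with
  | Top l x =>
      if l == k then Path 0 x
      else if [&& l.+1 == k, b & x * d + i == (d ^ k).-1] then Sec 0 0
      else Top l.+1 (x * d + i)
  | Path t j => if t.+1 == k then Gad j 0 0 else Path t.+1 j
  | Sec l x => if l == k then Gad (width d k b + x) 0 0 else Sec l.+1 (x * d + i)
  | Gad q c y =>
      if i == 0 then (if c == 0 then Gad q 1 y else Gad q 0 (y.*2 + c))
      else Gad q (if y < L then c.+2 else if b && (c != 1) then 3 else 2) y
  end.

Lemma expd_pred_mod : (d ^ k).-1 %% d = d.-1.
Proof.
rewrite -(prednK k_gt0) expnSr.
have : 0 < d ^ k.-1 by rewrite expn_gt0 d_gt0.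
case: (d ^ k.-1) => // m _; rewrite mulSn.
have -> : (d + m * d).-1 = m * d + d.-1 by lia.
by rewrite modnMDl modn_small // ltn_predL.
Qed.

Lemma nth_child_vparent b bt v : valid d k L b v -> v <> Top 0 0 ->
  nth_child b (vparent d k L b bt v) (sibling_index v) = v.
Proof.
case: v => [l x|t j|l x|q c y] hv nv.
- case: l hv nv => [|l] /and3P[hl hx hw].
    by move: hx; rewrite expn0; case: (x) => // _ [].
  move=> _ /=; rewrite (ltn_eqF hl) -divn_eq ifN //.
  apply/and3P=> -[/eqP el eb /eqP ex]; move: hw.
  by rewrite el eqxx ex eb /width; lia.
- case/andP: hv => ht _; case: t ht {nv} => [|t] ht /=; first by rewrite eqxx.
  by rewrite (ltn_eqF ht).
- case/and3P: hv => eb hl; case: l hl {nv} => [|l] hl hx /=; last first.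
    by rewrite (ltn_eqF hl) -divn_eq.
  move: hx; rewrite expn0; case: x => // _.
  rewrite prednK // eqxx eb /= -{1}expd_pred_mod -divn_eq eqxx.
  by rewrite ltn_eqF // ltn_predL.
- case/and4P: hv => hq hc hy h3; case: c hc h3 {nv} => [|[|[|[|c]]]] //= _ h3.
  + case: y hy h3 => [|y] hy _ /=.
      by case: ltnP => hqw /=; rewrite ?prednK ?eqxx // subnKC.
    by case ho: (odd y); congr Gad; rewrite /= ?ho; lia.
  + by case hyL: (y < L) => //=; case: (b) => //=; case: ifP.
  + case hyL: (y < L) => //=; move: h3; rewrite hyL orbF => -> /=.
    by case: (bt q (y - L)).
Qed.

Lemma sibling_index_inj b bt u v : valid d k L b u -> valid d k L b v ->
  u <> Top 0 0 -> v <> Top 0 0 ->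
  vparent d k L b bt u = vparent d k L b bt v ->
  sibling_index u = sibling_index v -> u = v.
Proof.
move=> hu hv nu nv ep ei.
by rewrite -(nth_child_vparent bt hu nu) ep ei nth_child_vparent.
Qed.

(** * The trees as parent tables *)

Lemma decoding b : exists dec : 'I_(num_vertices b) -> vtx,
  forall o, valid d k L b (dec o) /\ o = enc b (dec o) :> nat.
Proof.
have /choice[dec hdec] (o : 'I_(num_vertices b)) :
    exists v, valid d k L b v /\ o = enc b v :> nat.
  by have [v hv <-] := enc_surj (ltn_ord o); exists v.
by exists dec.
Qed.

Section Tree.

Variables (b : bool) (bt : nat -> nat -> bool).

Definition tree_root : 'I_(num_vertices b) := Ordinal (num_vertices_gt0 b).

Definition tree_parent (v : 'I_(num_vertices b)) : 'I_(num_vertices b) :=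
  Ordinal (nparent_lt bt (ltn_ord v)).

Lemma enc_root : enc b (Top 0 0) = 0. Proof. by []. Qed.

Lemma tree_coordinates (o : 'I_(num_vertices b)) :
  exists2 v, valid d k L b v & o = enc b v :> nat.
Proof. by have [dec /(_ o)[]] := decoding b; exists (dec o). Qed.

Lemma tree_parent_root : tree_parent tree_root = tree_root.
Proof.
apply: val_inj => /=; rewrite -enc_root nparent_enc ?valid_root //=.
by rewrite div0n.
Qed.

(** The rank drops at every parent step; this yields both connectivity and the depth bound. *)
Lemma tree_depth_vertex (v : vtx) (o : 'I_(num_vertices b)) :
  valid d k L b v -> o = enc b v :> nat ->
  exists2 n, n <= rank v & iter n tree_parent o = tree_root.
Proof.
have [n] := ubnP (rank v); elim: n v o => // n IH v o hn hv ho.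
have [e0|ne0] := eqVneq (enc b v) 0.
  by exists 0 => //=; apply: val_inj; rewrite /= ho.
have nv : v <> Top 0 0 by move=> ev; move: ne0; rewrite ev.
have hr := rank_vparent bt hv nv.
have [|||m hm em] := IH (vparent d k L b bt v) (tree_parent o).
- exact: leq_trans hr _.
- exact: valid_vparent.
- by rewrite /= ho nparent_enc.
- by exists m.+1; [exact: leq_ltn_trans hm hr|rewrite iterSr].
Qed.

Lemma tree_connect (o : 'I_(num_vertices b)) : fconnect tree_parent o tree_root.
Proof.
have [v hv ho] := tree_coordinates o.
by have [n _ <-] := tree_depth_vertex hv ho; apply: fconnect_iter.
Qed.

Definition tree : rtree := RTree tree_parent_root tree_connect.

Lemma tree_depth : depth tree <= k.*2 + 3 * trunc_log 2 L.+1 + 7.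
Proof.
apply/bigmax_leqP => o _; have [v hv ho] := tree_coordinates o.
have [n hn e] := tree_depth_vertex hv ho.
rewrite /= -e; apply: leq_trans (findex_iter_le _ _ _) _.
exact: leq_trans hn (rank_le hv).
Qed.

Lemma child_coordinates (u v : vtx) (p c : 'I_(num_vertices b)) :
  valid d k L b u -> valid d k L b v -> p = enc b u :> nat -> c = enc b v :> nat ->
  child (T := tree) p c <-> v <> Top 0 0 /\ vparent d k L b bt v = u.
Proof.
move=> hu hv ep ec; split.
  case/andP=> /eqP hc /eqP hp; split.
    by move=> ev; apply: hc; apply: val_inj; rewrite /= ec ev.
  apply: (enc_inj (valid_vparent d_gt1 k_gt0 bt hv) hu).
  by rewrite -nparent_enc // -ec -ep -hp.
case=> nv ep'; apply/andP; split.
  apply/eqP => /(congr1 val) /= ec0; apply: nv.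
  by apply: (enc_inj hv (valid_root d L k_gt0 b)); rewrite -ec ec0.
by apply/eqP; apply: val_inj; rewrite /= ec ep nparent_enc // ep'.
Qed.

Lemma tree_degree (p : 'I_(num_vertices b)) : #|children (T := tree) p| <= d.
Proof.
have [u hu ep] := tree_coordinates p.
have [dec hdec] := decoding b.
pose idx o := Ordinal (sibling_index_lt (dec o)).
rewrite -[leqRHS]card_ord -(@card_in_imset _ _ idx) ?max_card // => c c'.
rewrite !inE => hc hc' /(congr1 val) /= ei.
have [hv ec] := hdec c; have [hv' ec'] := hdec c'.
have [nv ev] := (child_coordinates hu hv ep ec).1 hc.
have [nv' ev'] := (child_coordinates hu hv' ep ec').1 hc'.
apply: val_inj; rewrite /= ec ec'; congr (enc b _).
by apply: (@sibling_index_inj b bt); rewrite // ev.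
Qed.

End Tree.

Lemma tree_embeds btH btG :
  isomorphic_to_subtree (tree false btH) (tree true btG) <->
  vembeds d k L btH btG.
Proof.
(* Codes out of range default to the root; at valid coordinates [ordE] gives the true number. *)
pose ord b v : 'I_(num_vertices b) := insubd (tree_root b) (enc b v).
have ordE b v : valid d k L b v -> ord b v = enc b v :> nat.
  by move=> hv; rewrite val_insubd enc_lt.
have ord_inj b u v : valid d k L b u -> valid d k L b v -> ord b u = ord b v -> u = v.
  by move=> hu hv /(congr1 val); rewrite /= !ordE //; apply: enc_inj.
have vroot b : valid d k L b (Top 0 0) by exact: valid_root.
split=> [[F [F_inj F_root F_child]]|[f [f_valid f_inj f_root f_parent]]].
  have [decG hG] := decoding true.
  have hF v : F (ord false v) = enc true (decG (F (ord false v))) :> nat.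
    by have [] := hG (F (ord false v)).
  have vF v : valid d k L true (decG (F (ord false v))).
    by have [] := hG (F (ord false v)).
  exists (fun v => decG (F (ord false v))); split=> [v hv|u v hu hv e||v hv nv].
  - exact: vF.
  - apply: (ord_inj false) => //; apply: F_inj; apply: val_inj.
    by rewrite /= (hF u) (hF v) e.
  - apply: (enc_inj (vF _) (vroot true)); rewrite -hF.
    have -> : ord false (Top 0 0) = tree_root false.
      by apply: val_inj; rewrite /= ordE.
    by rewrite [F _]F_root.
  - have hp := valid_vparent d_gt1 k_gt0 btH hv.
    have /F_child : child (T := tree false btH)
        (ord false (vparent d k L false btH v)) (ord false v).
      by apply/(child_coordinates btH hp hv); rewrite ?ordE.
    by move/(child_coordinates btG (vF _) (vF _) (hF _) (hF _)) => -[].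
have [decH hH] := decoding false.
have vH o : valid d k L false (decH o) by have [] := hH o.
have eH (o : 'I_(num_vertices false)) : o = enc false (decH o) :> nat by have [] := hH o.
exists (fun o => ord true (f (decH o))); split=> [o o' e||p c].
- apply: val_inj; rewrite /= (eH o) (eH o'); congr (enc _ _).
  by apply: f_inj => //; apply: ord_inj e; apply: f_valid.
- have -> : decH (tree_root false) = Top 0 0.
    by apply: (enc_inj (vH _) (vroot false)); rewrite -eH.
  by apply: val_inj; rewrite /= f_root ordE.
- move/(child_coordinates btH (vH _) (vH _) (eH p) (eH c)) => -[nc ec].
  apply/(child_coordinates btG (f_valid _ (vH p)) (f_valid _ (vH c))).
  + by rewrite ordE //; apply: f_valid.
  + by rewrite ordE //; apply: f_valid.
  + split; last by rewrite f_parent // ec.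
    by rewrite -f_root => /(f_inj _ _ (vH c) (vroot false)).
Qed.

End Numbering.

(** * Running time of programs *)

Section Verification.

Variable R : nat.

Definition bounded (s : state) : Prop :=
  (forall x, reg s x <= R) /\ (forall a, Defs.mem s a <= R).

(* In a bounded state every node of an expression except a product is at most R
   times the number of its leaves, so only products and constants need an
   explicit check. *)
Fixpoint products_le (s : state) (e : expr) : bool :=
  match e with
  | Const n => n <= R
  | Reg _ => true
  | Fetch e1 => products_le s e1
  | Binop o e1 e2 =>
      [&& if o is OpMul then eval s e1 * eval s e2 <= R else true,
          products_le s e1 & products_le s e2]
  end.

(** Weakest preconditions of loop-free code, including that every stored value is at most [R]. Loops
    are left to [while_exec]. *)
Fixpoint wp (p : prog) (s : state) (Q : state -> Prop) : Prop :=
  match p with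
  | Skip => Q s
  | Assign x e => [/\ products_le s e, eval s e <= R & Q (set_reg s x (eval s e))]
  | Store e1 e2 =>
      [/\ products_le s e1, products_le s e2, eval s e2 <= R &
          Q (set_mem s (eval s e1) (eval s e2))]
  | Seq p1 p2 => wp p1 s (fun s' => wp p2 s' Q)
  | If e p1 p2 => products_le s e /\ (if eval s e == 0 then wp p2 s Q else wp p1 s Q)
  | While _ _ => False
  end.

(** For loop-free code this bounds the time and, multiplied by [R], a sufficient word size; the two
    branches of [If] are simply added. *)
Fixpoint prog_cost (p : prog) : nat :=
  match p with
  | Skip => 1
  | Assign _ e => (cost e).+1
  | Store e1 e2 => (cost e1 + cost e2).+1
  | Seq p1 p2 => prog_cost p1 + prog_cost p2
  | If e p1 p2 => (cost e + (prog_cost p1 + prog_cost p2)).+1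
  | While _ _ => 0
  end.

Hypothesis R_gt0 : 0 < R.

Lemma eval_le s e : bounded s -> products_le s e -> eval s e <= cost e * R.
Proof.
move=> [hreg hmem]; elim: e => [n|x|e IH|o e1 IH1 e2 IH2] /=.
- by rewrite mul1n.
- by rewrite mul1n.
- by move=> _; rewrite mulSn; apply: leq_trans (hmem _) (leq_addr _ _).
- case/and3P=> ho /IH1 h1 /IH2 h2; rewrite mulSn mulnDl.
  case: o ho => /= ho.
  + by lia.
  + by lia.
  + by apply: leq_trans ho (leq_addr _ _).
  + by have := leq_div (eval s e1) (eval s e2); lia.
  + by have := leq_mod (eval s e1) (eval s e2); lia.
  + by case: (_ < _); lia.
  + by case: (_ == _); lia.
Qed.

Lemma fits_products W s e :
  bounded s -> products_le s e -> cost e * R <= W -> fits W s e.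
Proof.
move=> hs; elim: e => [n|x|e IH|o e1 IH1 e2 IH2] hp hW;
  have hle := leq_trans (eval_le hs hp) hW; rewrite /= in hle hp hW *; rewrite hle //=.
  by apply: IH => //; move: hW; rewrite mulSn; lia.
case/and3P: hp => _ hp1 hp2; move: hW; rewrite mulSn mulnDl => hW.
by rewrite IH1 ?IH2 //; lia.
Qed.

Lemma cost_gt0 e : 0 < cost e. Proof. by case: e. Qed.

Lemma bounded_set_reg s x v : bounded s -> v <= R -> bounded (set_reg s x v).
Proof. by move=> [hreg hmem] hv; split=> //= y; case: ifP. Qed.

Lemma bounded_set_mem s a v : bounded s -> v <= R -> bounded (set_mem s a v).
Proof. by move=> [hreg hmem] hv; split=> //= y; case: ifP. Qed.

Lemma wp_exec W p s Q : bounded s -> wp p s Q -> prog_cost p * R <= W ->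
  exists t s', [/\ t <= prog_cost p, exec W p s t s', bounded s' & Q s'].
Proof.
elim: p s Q => [|x e|e1 e2|p1 IH1 p2 IH2|e p1 IH1 p2 IH2|e p IH] s Q hs //=.
- by move=> hQ _; exists 1, s; split=> //; apply: exec_skip.
- case=> hp hv hQ hW; exists (cost e).+1, (set_reg s x (eval s e)); split=> //.
    by apply: exec_assign; apply: fits_products => //; move: hW; rewrite mulSn; lia.
  exact: bounded_set_reg.
- case=> hp1 hp2 hv hQ; rewrite mulSn mulnDl => hW.
  exists (cost e1 + cost e2).+1, (set_mem s (eval s e1) (eval s e2)); split=> //.
    by apply: exec_store; apply: fits_products => //; lia.
  exact: bounded_set_mem.
- rewrite mulnDl => /(IH1 s _ hs) h1 hW.
  have [|t1 [s1 [ht1 ex1 hs1 /(IH2 s1 _ hs1) h2]]] := h1; first by lia.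
  have [|t2 [s2 [ht2 ex2 hs2 hQ]]] := h2; first by lia.
  exists (t1 + t2), s2; split=> //; first exact: leq_add.
  exact: exec_seq ex1 ex2.
- case=> hp; rewrite mulSn !mulnDl; have hc := cost_gt0 e.
  case: eqP => he h hW.
    have [|t [s' [ht ex hs' hQ]]] := IH2 s Q hs h; first by lia.
    exists (cost e + t).+1, s'; split=> //; first by lia.
    by apply: exec_if_false => //; apply: fits_products => //; lia.
  have [|t [s' [ht ex hs' hQ]]] := IH1 s Q hs h; first by lia.
  exists (cost e + t).+1, s'; split=> //; first by lia.
  by apply: exec_if_true => //; [apply: fits_products => //; lia|apply/eqP].
Qed.

Lemma wp_seq p1 p2 s Q : wp p1 s (fun s' => wp p2 s' Q) -> wp (Seq p1 p2) s Q.
Proof. by []. Qed.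

Lemma wp_mono p s (Q Q' : state -> Prop) :
  (forall s', Q s' -> Q' s') -> wp p s Q -> wp p s Q'.
Proof.
elim: p s Q Q' => [|x e|e1 e2|p1 IH1 p2 IH2|e p1 IH1 p2 IH2|e p IH] s Q Q' hQ //=.
- exact: hQ.
- by case=> h1 h2 /hQ.
- by case=> h1 h2 h3 /hQ.
- by apply: IH1 => s'; apply: IH2.
- by case=> h1 h2; split=> //; case: ifP h2 => _; [apply: IH2|apply: IH1].
Qed.

(** The invariant is indexed by the number of completed rounds, so it also settles termination. *)
Lemma while_exec W e p (I : nat -> state -> Prop) n s :
  prog_cost p * R <= W -> cost e * R <= W ->
  (forall i s, i < n -> bounded s -> I i s ->
    [/\ products_le s e, eval s e != 0 & wp p s (I i.+1)]) ->
  (forall s, I n s -> products_le s e /\ eval s e = 0) ->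
  bounded s -> I 0 s ->
  exists t s', [/\ t <= n.+1 * (cost e + prog_cost p).+1, exec W (While e p) s t s',
                   bounded s' & I n s'].
Proof.
move=> hWp hWe step stop hs h0.
suff loop m i s0 : i + m = n -> bounded s0 -> I i s0 ->
    exists t s', [/\ t <= m.+1 * (cost e + prog_cost p).+1,
                     exec W (While e p) s0 t s', bounded s' & I n s'].
  exact: loop (add0n n) hs h0.
elim: m i s0 => [|m IH] i s0 hi hs0 hI.
  rewrite addn0 in hi; subst i; have [hp he] := stop s0 hI.
  exists (cost e).+1, s0; split=> //; first by rewrite mul1n; lia.
  by apply: exec_while_false => //; apply: fits_products.
have [|hp he hw] := step i s0 _ hs0 hI; first by lia.
have [t1 [s1 [ht1 ex1 hs1 hI1]]] := wp_exec hs0 hw hWp.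
have [|t2 [s2 [ht2 ex2 hs2 hI2]]] := IH i.+1 s1 _ hs1 hI1; first by lia.
exists (cost e + t1 + t2).+1, s2; split=> //; first by rewrite mulSn; lia.
by apply: exec_while_true ex1 ex2 => //; apply: fits_products.
Qed.

End Verification.

(** * The construction as a program *)

Local Notation rN := 0.
Local Notation rD := 1.
Local Notation rM := 3.
Local Notation rk := 4.
Local Notation rT := 5.
Local Notation rw := 6.
Local Notation rS := 7.
Local Notation rG := 8.
Local Notation rK := 9.
Local Notation rP := 10.
Local Notation rn := 11.
Local Notation rbase := 12.
Local Notation rv := 13.
Local Notation rL := 14.
Local Notation rq := 15.
Local Notation rg := 16.
Local Notation rc := 17.
Local Notation ry := 18.
Local Notation rpar := 19.
Local Notation rbit := 20.
Local Notation rcopy := 21.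

Local Notation add := (Binop OpAdd).
Local Notation sub := (Binop OpSub).
Local Notation mul := (Binop OpMul).
Local Notation div := (Binop OpDiv).
Local Notation mod := (Binop OpMod).
Local Notation lt := (Binop OpLt).
Local Notation eq := (Binop OpEq).

Section Program.

Variables (d : nat) (b : bool).

(** The loop carries [d ^ k], [k] and [heap_size d k], starting at [k = 1] so that [k] is positive
    even for [N = 1]. *)
Definition level_init : prog :=
  Seq (Assign rM (Const d)) (Seq (Assign rk (Const 1)) (Assign rT (Const 1))).

Definition level_guard : expr := lt (Reg rM) (Reg rN).

Definition level_step : prog :=
  Seq (Assign rT (add (Reg rT) (Reg rM)))
 (Seq (Assign rM (mul (Reg rM) (Const d)))
      (Assign rk (add (Reg rk) (Const 1)))).

Definition sizes : prog :=
  Seq (Assign rw (sub (Reg rM) (Const b)))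
 (Seq (Assign rL (sub (Reg rD) (Const 1)))
 (Seq (Assign rK (add (add (Reg rL) (Reg rL)) (Const 1)))
 (Seq (Assign rP (add (mul (Const 3) (Reg rK)) (Reg (if b then rK else rL))))
 (Seq (Assign rS (add (Reg rT) (mul (add (Reg rk) (Const 1)) (Reg rw))))
 (Seq (Assign rG (if b then add (Reg rS) (add (Reg rT) (Reg rM)) else Reg rS))
 (Seq (Assign rn (add (Reg rG)
         (mul (if b then add (Reg rw) (Reg rM) else Reg rw) (Reg rP))))
      (Assign rbase (mul (Reg rN) (Reg rD))))))))).

(** Reducing the row modulo [N] makes the gadgets cycle through all vectors. At internal nodes the
    truncated difference is 0, so the address stays inside the input. *)
Definition bit_address (row : expr) : expr :=
  add (mul (mod row (Reg rN)) (Reg rD)) (sub (Reg ry) (Reg rL)).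

Definition load_bit : prog :=
  if b then
    If (lt (Reg rq) (Reg rw)) (Assign rbit (Const 0))
      (Assign rbit (Fetch (bit_address (sub (Reg rq) (Reg rw)))))
  else Assign rbit (Fetch (bit_address (Reg rq))).

Definition compute_copy : prog :=
  If (eq (Reg rc) (Const 0)) (Assign rcopy (sub (Const 2) (mod (Reg ry) (Const 2))))
 (If (eq (Reg rc) (Const 1)) (Assign rcopy (Const 0))
 (If (eq (Reg rc) (Const 2))
   (If (lt (Reg ry) (Reg rL)) (Assign rcopy (Const 0))
      (if b then Assign rcopy (Const 1)
       else If (Reg rbit) (Assign rcopy (Const 0)) (Assign rcopy (Const 1))))
   (If (lt (Reg ry) (Reg rL)) (Assign rcopy (Const 1))
      (If (Reg rbit) (Assign rcopy (Const 2)) (Assign rcopy (Const 0)))))).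

Definition gadget_coordinates : prog :=
  Seq (Assign rq (div (sub (Reg rv) (Reg rG)) (Reg rP)))
 (Seq (Assign rg (mod (sub (Reg rv) (Reg rG)) (Reg rP)))
 (Seq (Assign rc (div (Reg rg) (Reg rK)))
      (Assign ry (mod (Reg rg) (Reg rK))))).

Definition gadget_parent : prog :=
  Seq load_bit
 (Seq compute_copy
 (If (eq (Reg rc) (Const 0))
   (Assign rpar (add (add (sub (Reg rv) (Reg rg)) (mul (Reg rcopy) (Reg rK)))
                     (div (sub (Reg ry) (Const 1)) (Const 2))))
   (Assign rpar (add (add (sub (Reg rv) (Reg rg)) (mul (Reg rcopy) (Reg rK)))
                     (Reg ry))))).

(* The last row of path vertices starts at rS - rw. *)
Definition compute_parent : prog :=
  If (lt (Reg rv) (add (Reg rT) (Reg rw)))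
     (Assign rpar (div (sub (Reg rv) (Const 1)) (Const d)))
 (If (lt (Reg rv) (Reg rS)) (Assign rpar (sub (Reg rv) (Reg rw)))
 (If (lt (Reg rv) (Reg rG))
   (If (eq (Reg rv) (Reg rS))
      (Assign rpar (div (sub (add (Reg rT) (Reg rM)) (Const 2)) (Const d)))
      (Assign rpar (add (Reg rS)
                        (div (sub (sub (Reg rv) (Reg rS)) (Const 1)) (Const d)))))
   (Seq gadget_coordinates
   (If (eq (Reg rg) (Const 0))
      (If (lt (Reg rq) (Reg rw))
         (Assign rpar (add (sub (Reg rS) (Reg rw)) (Reg rq)))
         (Assign rpar (add (add (sub (Reg rS) (Reg rw)) (Reg rq)) (Reg rT))))
      gadget_parent)))).

(** The table starts at address [N * D], just after the input, which thus stays readable. *)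
Definition vertex_step : prog :=
  Seq compute_parent
 (Seq (Store (add (Reg rbase) (Reg rv)) (Reg rpar))
      (Assign rv (add (Reg rv) (Const 1)))).

(** Register 2 keeps its initial 0, the number of the root. *)
Definition construction : prog :=
  Seq level_init
 (Seq (While level_guard level_step)
 (Seq sizes
 (Seq (While (lt (Reg rv) (Reg rn)) vertex_step)
 (Seq (Assign 0 (Reg rn)) (Assign 1 (Reg rbase)))))).

End Program.

(** * Correctness and running time of the construction *)

Section Correctness.

Variables (d N D : nat) (b : bool) (inp : nat -> bool).
Hypotheses (d_gt1 : 1 < d) (N_gt0 : 0 < N) (D_gt0 : 0 < D).

(** The least positive [k] with [N <= d ^ k]. *)
Definition levels : nat := maxn 1 (up_log d N).

Let k := levels.
Let L := D.-1.

Definition gadget_bit (q i : nat) : bool :=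
  if b && (q < width d k b) then false
  else inp ((if b then q - width d k b else q) %% N * D + i).

Definition register_values (v : nat) : seq nat :=
  [:: N; D; 0; d ^ k; k; heap_size d k; width d k b; grafted_base d k b;
      gadget_base d k b; L.*2.+1; gadget_size L b; num_vertices d k L b; N * D; v; L].

Definition registers (v : nat) (s : state) : Prop :=
  forall x, x < 15 -> reg s x = nth 0 (register_values v) x.

Definition memory (v : nat) (s : state) : Prop :=
  (forall a, a < N * D -> Defs.mem s a = inp a) /\
  (forall u, u < v -> Defs.mem s (N * D + u) = nparent d k L b gadget_bit u).

Variable R : nat.
Hypotheses (R_ge4 : 4 <= R) (R_ge_d : d <= R) (R_ge_ND : N * D <= R)
  (R_ge_n : num_vertices d k L b <= R) (R_ge_M : heap_size d k + d ^ k <= R).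

Let d_gt0 : 0 < d. Proof. exact: ltnW. Qed.

Lemma levels_gt0 : 0 < levels. Proof. exact: leq_maxl. Qed.

(** Registers below 15 persist; computing a parent writes only scratch registers from 15 on and no
    memory. *)
Definition frame (s s' : state) : Prop :=
  (forall x, x < 15 -> reg s' x = reg s x) /\ Defs.mem s' = Defs.mem s.

Lemma frame_set_reg s s' x v : 15 <= x -> frame s s' -> frame s (set_reg s' x v).
Proof.
move=> hx [hr hm]; split=> //= y hy; rewrite ifN ?hr //.
by rewrite neq_ltn (leq_trans hy hx).
Qed.

Lemma gadget_count_gt0 : 0 < width d k b + b * d ^ k.
Proof.
have := expd_gt1 d_gt1 levels_gt0; rewrite -/k /width.
by case: b => /=; lia.
Qed.

Lemma gadget_size_le : gadget_size L b <= R.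
Proof.
apply: leq_trans R_ge_n; rewrite /num_vertices.
by have := gadget_count_gt0; nia.
Qed.

Lemma wp_compute_copy s (bit : bool) c y :
  reg s rc = c -> reg s ry = y -> reg s rL = L -> reg s rbit = bit ->
  wp R (compute_copy b) s (fun s' => s' = set_reg s rcopy (copy_parent L b bit c y)).
Proof.
move=> rc ry rL rbit; rewrite /compute_copy /copy_parent /= rc ry rL.
have [hR1 hR2] : 1 <= R /\ 2 <= R by lia.
have h2 : 2 - y %% 2 <= R by lia.
rewrite !eqb0; case: (c == 0) => /=; first by rewrite hR2.
split=> //; case: (c == 1) => //=.
split=> //; case: (c == 2) => /=; split=> //; case: (y < L) => //=.
  by case: (b) => //=; rewrite rbit; case: bit {rbit}.
by rewrite rbit; case: bit {rbit}.
Qed.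

Lemma wp_load_bit s q y :
  reg s rN = N -> reg s rD = D -> reg s rw = width d k b -> reg s rL = L ->
  reg s rq = q -> reg s ry = y -> y < L.*2.+1 ->
  (forall a, a < N * D -> Defs.mem s a = inp a) ->
  wp R (load_bit b) s (fun s' => s' = set_reg s rbit (gadget_bit q (y - L))).
Proof.
move=> r0 r1 r6 r14 r15 r18 hy hinp.
have hrow x : x %% N * D + (y - L) < N * D.
  have hx := ltn_pmod x N_gt0; have hL : y - L < D by lia.
  have : (x %% N).+1 * D <= N * D by rewrite leq_mul2r hx orbT.
  by rewrite mulSn; lia.
have hrowR x : x %% N * D <= R.
  by apply: leq_trans R_ge_ND; apply: leq_trans (ltnW (hrow x)); apply: leq_addr.
have hbit (x : bool) : x <= R by apply: leq_trans R_ge4; case: x.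
rewrite /load_bit /gadget_bit; move: r6; case: (b) => r6 /=; last first.
  by rewrite r15 r0 r1 r18 r14 hinp // hrowR.
rewrite r15 r6 eqb0; split=> //; case: ltnP => hq /=; first by split.
by rewrite r0 r1 r18 r14 hinp // hrowR.
Qed.

Local Ltac wp_split :=
  repeat (match goal with |- frame _ _ => fail 1 | |- _ /\ _ => split
                        | |- [/\ _, _ & _] => split end; rewrite //=).

Lemma wp_gadget_parent s v g q c y :
  reg s rN = N -> reg s rD = D -> reg s rw = width d k b -> reg s rL = L ->
  reg s rK = L.*2.+1 -> reg s rv = v ->
  reg s rq = q -> reg s rg = g -> reg s rc = c -> reg s ry = y -> y < L.*2.+1 ->
  (forall a, a < N * D -> Defs.mem s a = inp a) ->
  let p := v - g + copy_parent L b (gadget_bit q (y - L)) c y * L.*2.+1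
         + (if c == 0 then (y - 1) %/ 2 else y) in
  p <= R ->
  wp R (gadget_parent b) s (fun s' => reg s' rpar = p /\ frame s s').
Proof.
move=> r0 r1 r6 r14 r9 r13 r15 r16 r17 r18 hy hinp p hp.
have [hR1 hR2] : 1 <= R /\ 2 <= R by lia.
rewrite /gadget_parent -/(wp R _ _ _).
apply: wp_mono (wp_load_bit r0 r1 r6 r14 r15 r18 hy hinp) => s1 ->.
apply: wp_mono (wp_compute_copy (bit := gadget_bit q (y - L)) (c := c) (y := y) _ _ _ _) => //.
move=> s2 ->; move: hp; rewrite /= r13 r16 r9 r17 r18 eqb0 {}/p.
have fr u1 u2 u3 : frame s (set_reg (set_reg (set_reg s rbit u1) rcopy u2) rpar u3).
  by do 3 apply: frame_set_reg => //.
by case: (c == 0) => /= hp; wp_split; rewrite ?hR1 ?hR2 ?andbT //; lia.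
Qed.

Lemma compute_parent_correct v s :
  v < num_vertices d k L b -> registers v s -> memory v s ->
  wp R (compute_parent d b) s (fun s' =>
    reg s' rpar = nparent d k L b gadget_bit v /\ frame s s').
Proof.
move=> hv hreg [hinp _].
have hk : 0 < k := levels_gt0.
have hn := ltnW (leq_trans (nparent_lt d_gt1 hk gadget_bit hv) R_ge_n).
have hP := gadget_size_le.
have hK : 3 * L.*2.+1 <= gadget_size L b by exact: leq_addr.
have r0 : reg s rN = N := hreg 0 isT.
have r1 : reg s rD = D := hreg 1 isT.
have r3 : reg s rM = d ^ k := hreg 3 isT.
have r5 : reg s rT = heap_size d k := hreg 5 isT.
have r6 : reg s rw = width d k b := hreg 6 isT.
have r7 : reg s rS = grafted_base d k b := hreg 7 isT.
have r8 : reg s rG = gadget_base d k b := hreg 8 isT.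
have r9 : reg s rK = L.*2.+1 := hreg 9 isT.
have r10 : reg s rP = gadget_size L b := hreg 10 isT.
have r13 : reg s rv = v := hreg 13 isT.
have r14 : reg s rL = L := hreg 14 isT.
have hR2 : 2 <= R by apply: leq_trans R_ge4.
have hR1 : 1 <= R by apply: leq_trans R_ge4.
move: hn; rewrite /nparent /compute_parent /= !(r3, r5, r6, r7, r8, r9, r10, r13) !eqb0.
have fr x u : 15 <= x -> frame s (set_reg s x u) by move=> hx; apply: frame_set_reg.
case: (ltnP v (heap_size d k + width d k b)) => h1 /=.
  by move=> hn; wp_split; rewrite ?R_ge_d ?hR1 //; apply: fr.
case: (ltnP v (grafted_base d k b)) => h2 /=.
  by move=> hn; wp_split; apply: fr.
case: (ltnP v (gadget_base d k b)) => h3 /=.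
  by case: (v == _) => /= hn; wp_split; rewrite ?R_ge_d ?hR1 ?hR2 //; apply: fr.
set q := _ %/ gadget_size L b; set g := _ %% gadget_size L b.
set c := g %/ _; set y := g %% _ => hn.
have hvR : v <= R := ltnW (leq_trans hv R_ge_n).
have hq : q <= R by apply: leq_trans hvR; apply: leq_trans (leq_div _ _) (leq_subr _ _).
have hg : g <= R by apply: leq_trans hvR; apply: leq_trans (leq_mod _ _) (leq_subr _ _).
have hc : c <= R := leq_trans (leq_div _ _) hg.
have hy : y <= R := leq_trans (leq_mod _ _) hg.
wp_split.
have frg : frame s (set_reg (set_reg (set_reg (set_reg s rq q) rg g) rc c) ry y).
  by do 4 apply: frame_set_reg => //.
have hS : grafted_base d k b - width d k b = heap_size d k + k * width d k b.
  by rewrite /grafted_base mulSn; lia.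
case: (g =P 0) hn => [g0|_] hn /=.
  rewrite hS; move: hn; case: (ltnP q (width d k b)) => hqw /= hn; wp_split;
    rewrite ?addn0 // in hn *; exact: frame_set_reg.
have hyK : y < L.*2.+1 by apply: ltn_pmod.
set s1 := set_reg _ ry y in frg *.
have hw := @wp_gadget_parent s1 v g q c y r0 r1 r6 r14 r9 r13 erefl erefl erefl erefl hyK hinp hn.
refine (_ : wp R (gadget_parent b) s1 (fun s' => reg s' rpar = _ /\ frame s s')).
apply: (wp_mono _ hw) => s' [-> [fr1 fr2]]; split=> //; split=> [x hx|].
  by rewrite fr1 // frg.1.
by rewrite fr2 frg.2.
Qed.

Lemma wp_vertex_step v s :
  v < num_vertices d k L b -> registers v s -> memory v s ->
  wp R (vertex_step d b) s (fun s' => registers v.+1 s' /\ memory v.+1 s').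
Proof.
move=> hv hreg hmem.
have hk : 0 < k := levels_gt0.
have hn := ltnW (leq_trans (nparent_lt d_gt1 hk gadget_bit hv) R_ge_n).
have hvR := leq_trans hv R_ge_n.
apply: wp_seq.
apply: (wp_mono _ (compute_parent_correct hv hreg hmem)) => s' [hp [fr1 fr2]] /=.
have r12 : reg s' rbase = N * D by rewrite fr1 // hreg.
have r13 : reg s' rv = v by rewrite fr1 // hreg.
rewrite hp r12 r13 addn1; split=> //; split=> //; try lia.

case: hmem => hinp hout; split; [|split] => x hx /=.
- case: eqP => [->//|ne]; rewrite fr1 // hreg //.
  by do 15 (case: x hx ne => [|x] hx ne //).
- by rewrite ifN ?fr2 ?hinp // neq_ltn (leq_trans hx (leq_addr _ _)).
- rewrite eqn_add2l; case: eqP => [->//|ne]; rewrite fr2 hout //.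
  by lia.
Qed.

(** After [i] rounds level [i.+1] is reached, so the loop takes [k.-1] rounds. *)
Definition level_registers (s0 : state) (i : nat) (s : state) : Prop :=
  [/\ [/\ reg s rN = N, reg s rD = D, reg s 2 = 0 & reg s rv = 0],
      [/\ reg s rM = d ^ i.+1, reg s rk = i.+1 & reg s rT = heap_size d i.+1] &
      Defs.mem s = Defs.mem s0].

Lemma levels_lt_R : levels.+1 < R.
Proof.
have : levels < d ^ levels by exact: ltn_expl.
by have := heap_size_gt0 d levels_gt0; move: R_ge_M; rewrite /k; lia.
Qed.

Lemma wp_level_step s0 i s : i < k.-1 -> level_registers s0 i s ->
  wp R (level_step d) s (level_registers s0 i.+1).
Proof.
move=> hi [[r0 r1 r2 r13] [r3 r4 r5] hm]; rewrite /= r3 r4 r5 addn1 -expnSr -heap_sizeS.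
have hik : i.+2 <= k by lia.
have hM : d ^ i.+2 <= d ^ k by rewrite leq_exp2l.
have hT : heap_size d i.+2 <= heap_size d k by exact: heap_size_mono.
have hkR := levels_lt_R; rewrite -/k in hkR.
have hMR : d ^ i.+2 <= R := leq_trans hM (leq_trans (leq_addl _ _) R_ge_M).
split=> //; first exact: leq_trans hT (leq_trans (leq_addr _ _) R_ge_M).
by rewrite hMR R_ge_d; split=> //; split=> //; lia.
Qed.

Lemma level_guard_true i : i < k.-1 -> d ^ i.+1 < N.
Proof.
move=> hi; rewrite ltnNge; apply/negP => /(up_log_min d_gt1) h.
by move: hi; rewrite /k /levels; lia.
Qed.

Lemma levels_expd : N <= d ^ k.
Proof.
apply: leq_trans (up_logP N d_gt1) _; rewrite leq_exp2l //; exact: leq_maxr.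
Qed.

Lemma wp_sizes s0 s : (forall a, a < N * D -> Defs.mem s0 a = inp a) ->
  level_registers s0 k.-1 s ->
  wp R (sizes b) s (fun s' => registers 0 s' /\ memory 0 s').
Proof.
move=> hinp [[r0 r1 r2 r13] [r3 r4 r5] hm].
have hkR := levels_lt_R; rewrite -/k in hkR.
have hP := gadget_size_le.
have hK : 3 * L.*2.+1 <= gadget_size L b by exact: leq_addr.
rewrite prednK ?levels_gt0 // in r3 r4 r5.
have eP : 3 * L.*2.+1 + (if b then L.*2.+1 else L) = gadget_size L b by [].
have eS : heap_size d k + k.+1 * width d k b = grafted_base d k b by [].
have eG : (if b then grafted_base d k b + (heap_size d k + d ^ k)
           else grafted_base d k b) = gadget_base d k b.
  by rewrite /gadget_base; case: b; rewrite ?mul1n ?addn0.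
have eQ : (if b then width d k b + d ^ k else width d k b)
    = width d k b + b * d ^ k.
  by case: b; rewrite ?mul1n ?addn0.
have en : gadget_base d k b + (width d k b + b * d ^ k) * gadget_size L b
    = num_vertices d k L b by [].
have hGn := num_vertices_ge d k L b.
have hSG := gadget_base_ge d k b.
have hw : width d k b <= R.
  by apply: leq_trans (width_le d k b) (leq_trans (leq_addl _ _) R_ge_M).
have hS : grafted_base d k b <= R by lia.
have hkw : k.+1 * width d k b <= R by apply: leq_trans hS; rewrite -eS leq_addl.
have hQP : (width d k b + b * d ^ k) * gadget_size L b <= R.
  by apply: leq_trans R_ge_n; rewrite -en leq_addl.
have hLR : L <= R by lia.
have hKR : L.*2.+1 <= R by lia.
have h3K : 3 * L.*2.+1 <= R by lia.
have h3 : 2 < R by lia.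
have hb : b <= R by case: (b); lia.
have hG : gadget_base d k b <= R by lia.
have h1 : 0 < R by lia.
have hreg s' : (forall x, x < 15 -> reg s' x = nth 0 (register_values 0) x) ->
    Defs.mem s' = Defs.mem s -> registers 0 s' /\ memory 0 s'.
  by move=> hr hm'; split=> //; split=> // a ha; rewrite hm' hm hinp.
move: hreg; rewrite /register_values /=.
rewrite r0 r1 r3 r4 r5 !subn1 -/L -/(width d k b) addnn !addn1.
have hnR := R_ge_n.
move: eP eS eG eQ en hGn hSG hw hS hkw hQP hG hP hnR hK.
set w := width d k b; set S := grafted_base d k b; set G := gadget_base d k b.
set n := num_vertices d k L b; set P := gadget_size L b.
move=> eP eS eG eQ en hGn hSG hw hS hkw hQP hG hP hnR hK hreg.
have hr s' : reg s' rN = N -> reg s' rD = D -> reg s' 2 = 0 -> reg s' rv = 0 ->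
    reg s' rM = d ^ k -> reg s' rk = k -> reg s' rT = heap_size d k ->
    [/\ reg s' rw = w, reg s' rS = S, reg s' rG = G, reg s' rK = L.*2.+1 &
     [/\ reg s' rP = P, reg s' rn = n, reg s' rbase = N * D & reg s' rL = L]] ->
    Defs.mem s' = Defs.mem s -> registers 0 s' /\ memory 0 s'.
  move=> e0 e1 e2 e13 e3 e4 e5 [e6 e7 e8 e9 [e10 e11 e12 e14]]; apply: hreg => x.
  by do 15 (case: x => [|x] //).
move: eP eG eQ en hb hQP; case: (b) => /= eP eG eQ en hb hQP.
  rewrite r3 r5 eP eS eG eQ en ?andbT hQP h3K h3 hkw h1 R_ge_ND.
  by do 8 (split=> //); apply: hr.
rewrite eP eS -[w in w * P]addn0 -[X in w + X](mul0n (d ^ k)) eG en.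
rewrite ?andbT hQP h3K h3 hkw h1 R_ge_ND.
by do 8 (split=> //); apply: hr.
Qed.

Lemma prog_cost_sizes : prog_cost (sizes b) <= 100.
Proof. by rewrite /sizes; case: (b). Qed.

Lemma prog_cost_vertex_step : prog_cost (vertex_step d b) <= 400.
Proof. by rewrite /vertex_step /compute_parent /gadget_parent /load_bit /compute_copy; case: (b). Qed.

(** The level loop has fewer than [R] rounds and the vertex loop at most [R], each of constant cost
    independent of [d]; a vertex round costs at most 404. *)
Lemma construction_correct (A : N.-tuple (D.-tuple bool)) W :
  inp =1 nth false (flatten [seq tval a | a <- A]) -> 1000 * R <= W ->
  constructs_in_time W (construction d b) A
    (tree L d_gt1 levels_gt0 b gadget_bit) (1000 * R).
Proof.
move=> hinp hW; have R_gt0 : 0 < R by lia.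
have hfit c : c <= 1000 -> c * R <= W.
  by move=> hc; apply: leq_trans hW; rewrite leq_mul2r hc orbT.
have hkR := levels_lt_R; have hk0 := levels_gt0.
have hb0 : bounded R (input A).
  split=> /= x; last by case: nth.
  case: x => [|[|x]] /=; rewrite ?nth_nil //; apply: leq_trans R_ge_ND.
    by rewrite leq_pmulr.
  by rewrite leq_pmull.
have hw1 : wp R (level_init d) (input A) (level_registers (input A) 0).
  rewrite /= R_ge_d R_gt0; do 3 split=> //; split=> //.
have [|t1 [s1 [ht1 ex1 hb1 hl1]]] := wp_exec R_gt0 (W := W) hb0 hw1; first exact: hfit.
have step2 i s : i < k.-1 -> bounded R s -> level_registers (input A) i s ->
    [/\ products_le R s level_guard, eval s level_guard != 0 &
        wp R (level_step d) s (level_registers (input A) i.+1)].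
  move=> hi _ hl; split=> //; last exact: wp_level_step.
  by have [[r0 _ _ _] [r3 _ _] _] := hl; rewrite /= r0 r3 level_guard_true.
have stop2 s : level_registers (input A) k.-1 s ->
    products_le R s level_guard /\ eval s level_guard = 0.
  move=> [[r0 _ _ _] [r3 _ _] _]; split=> //=.
  by rewrite r0 r3 prednK // ltnNge levels_expd.
have [t2 [s2 [ht2 ex2 hb2 hl2]]] :=
  while_exec R_gt0 (hfit (prog_cost (level_step d)) isT) (hfit (cost level_guard) isT)
    step2 stop2 hb1 hl1.
have hw3 : wp R (sizes b) s2 (fun s' => registers 0 s' /\ memory 0 s').
  by apply: wp_sizes hl2 => a _; rewrite hinp.
have [|t3 [s3 [ht3 ex3 hb3 hl3]]] := wp_exec R_gt0 (W := W) hb2 hw3.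
  by apply: hfit; apply: leq_trans prog_cost_sizes _.
pose guard := lt (Reg rv) (Reg rn).
pose stored v s := registers v s /\ memory v s.
have step4 v s : v < num_vertices d k L b -> bounded R s -> stored v s ->
    [/\ products_le R s guard, eval s guard != 0 &
        wp R (vertex_step d b) s (stored v.+1)].
  move=> hv _ [hr hm]; split=> //; last exact: wp_vertex_step.
  by rewrite /= !hr //= hv.
have stop4 s : stored (num_vertices d k L b) s ->
    products_le R s guard /\ eval s guard = 0.
  by move=> [hr hm]; split=> //=; rewrite !hr //= ltnn.
have [t4 [s4 [ht4 ex4 hb4 [hr4 hm4]]]] :=
  while_exec R_gt0 (hfit _ (@leq_trans _ _ 1000 prog_cost_vertex_step isT)) (hfit (cost guard) isT)
    step4 stop4 hb3 hl3.
have hw5 : wp R (Seq (Assign 0 (Reg rn)) (Assign 1 (Reg rbase))) s4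
    (fun s => output s (tree L d_gt1 levels_gt0 b gadget_bit)).
  rewrite /= !hr4 //=; split=> //; split=> //; split=> /=; rewrite ?hr4 // => v.
  exact: hm4.2.
have [|t5 [s5 [ht5 ex5 hb5 ho]]] := wp_exec R_gt0 (W := W) hb4 hw5; first exact: hfit.
exists (t1 + (t2 + (t3 + (t4 + t5)))), s5; split=> //; last first.
  by do 4 (apply: exec_seq; first by eassumption).
have := (prog_cost_sizes, prog_cost_vertex_step) => -[hc3 hc4].
have ht3' := leq_trans ht3 hc3.
have ht4' : t4 <= (num_vertices d k L b).+1 * 404.
  by apply: leq_trans ht4 _; rewrite leq_mul2l /= !ltnS.
have := R_ge_n; move: ht1 ht2 ht5 => /= ht1 ht2 ht5.
move: (num_vertices _ _ _ _) ht4' => n ht4' hnR.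
rewrite prednK // in ht2; rewrite -/k in hkR.
lia.
Qed.

End Correctness.

(** * Sizes, depth and orthogonal pairs *)

Definition input_bits (N D : nat) (A : N.-tuple (D.-tuple bool)) : nat -> bool :=
  nth false (flatten [seq tval a | a <- A]).

Definition vector_tree (d : nat) (d_gt1 : 1 < d) (b : bool) (N D : nat)
    (A : N.-tuple (D.-tuple bool)) : rtree :=
  tree D.-1 d_gt1 (levels_gt0 d N) b (gadget_bit d N D b (input_bits A)).

Lemma nth_flatten_block (T : Type) (x0 : T) (D : nat) (ss : seq (seq T)) r i :
  all (fun s => size s == D) ss -> i < D ->
  nth x0 (flatten ss) (r * D + i) = nth x0 (nth [::] ss r) i.
Proof.
elim: ss r => [|s ss IH] r /=; first by rewrite !nth_nil.
case/andP=> /eqP hs hss hi; rewrite nth_cat hs.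
case: r => [|r]; first by rewrite mul0n add0n hi.
rewrite mulSn -addnA ltnNge leq_addr /= addKn.
exact: IH.
Qed.

Lemma input_bitsE (N D : nat) (A : N.-tuple (D.-tuple bool)) (r : 'I_N) (i : 'I_D) :
  input_bits A (r * D + i) = tnth (tnth A r) i.
Proof.
rewrite /input_bits nth_flatten_block //.
  rewrite (nth_map (tnth A r)) ?size_tuple // -tnth_nth -tnth_nth //.
by apply/allP => s /mapP[a _ ->]; rewrite size_tuple.
Qed.

Lemma dot_eq0 (D : nat) (u v : D.-tuple bool) :
  dot u v = 0 <-> forall i, ~~ (tnth u i && tnth v i).
Proof.
rewrite /dot; split=> [/eqP|h].
  rewrite sum_nat_eq0 => /forallP h i; have := h i; rewrite muln_eq0 !eqb0.
  by rewrite negb_and.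
apply: big1 => i _; have := h i; rewrite negb_and.
by case/orP=> /negbTE->; rewrite ?muln0.
Qed.

Section Bounds.

Variables (d N D : nat).
Hypotheses (d_gt1 : 1 < d) (N_gt0 : 0 < N) (D_gt0 : 0 < D).

(** Gadget indices reduce modulo [N] to vectors, and since [N <= d ^ k] every vector has a
    gadget. *)
Lemma vector_tree_embeds (A B : N.-tuple (D.-tuple bool)) :
  isomorphic_to_subtree (vector_tree d_gt1 false A) (vector_tree d_gt1 true B) <->
  exists a b, [/\ a \in A, b \in B & dot a b = 0].
Proof.
have hk := levels_gt0 d N.
have bit0 q i : q < width d (levels d N) true ->
    gadget_bit d N D true (input_bits B) q i = false.
  by rewrite /gadget_bit /= => ->.
rewrite tree_embeds (vembeds_orthogonal D.-1 d_gt1 hk _ bit0).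
have bitH j i : gadget_bit d N D false (input_bits A) j i
    = input_bits A (j %% N * D + i) by [].
have bitG z i : gadget_bit d N D true (input_bits B) (width d (levels d N) true + z) i
    = input_bits B (z %% N * D + i).
  by rewrite /gadget_bit /= ltnNge leq_addr /= addKn.
split=> [[j [z [_ _ orth]]]|[a [c [/tnthP[r ->] /tnthP[r' ->] /dot_eq0 orth]]]].
  pose r := Ordinal (ltn_pmod j N_gt0); pose r' := Ordinal (ltn_pmod z N_gt0).
  exists (tnth A r), (tnth B r'); split; try exact: mem_tnth.
  apply/dot_eq0 => i; have := orth i; rewrite bitH bitG.
  rewrite -ltnS prednK // ltn_ord -(input_bitsE A r i) -(input_bitsE B r' i).
  exact.
have hN x : x < N -> x < d ^ levels d N.
  by move/leq_trans; apply; apply: levels_expd.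
exists r, r'; split; try exact/hN/ltn_ord.
move=> i; rewrite -ltnS prednK // => hi; rewrite bitH bitG !modn_small //.
by have := orth (Ordinal hi); rewrite -!input_bitsE.
Qed.

(** By minimality of [up_log]; for [levels d N = 1] the power is 1. *)
Lemma expd_levels_pred : d ^ (levels d N).-1 <= N.
Proof.
rewrite /levels; case: (ltnP 1 (up_log d N)) => h.
  apply/ltnW/up_log_gtn => //.
  by have := up_log_gt0 d N; rewrite d_gt1 (ltnW h) => /esym.
by [].
Qed.

Lemma expd_levels_le : d ^ levels d N <= d * N.
Proof.
by rewrite -(prednK (levels_gt0 d N)) expnS leq_mul2l expd_levels_pred orbT.
Qed.

Lemma uniq_vectors_le (A : N.-tuple (D.-tuple bool)) : uniq A -> N <= 2 ^ D.
Proof.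
move=> /card_uniqP hA; rewrite -[leqLHS](size_tuple A) -hA -card_bool -card_tuple.
exact: max_card.
Qed.

Lemma levels_le (A : N.-tuple (D.-tuple bool)) : uniq A -> levels d N <= D.
Proof.
move=> /uniq_vectors_le hN; rewrite geq_max D_gt0 up_log_min //.
by apply: leq_trans hN _; rewrite leq_exp2r.
Qed.

Lemma num_vertices_le (b : bool) (A : N.-tuple (D.-tuple bool)) : uniq A ->
  num_vertices d (levels d N) D.-1 b <= 30 * (d * (N * D)).
Proof.
move=> /levels_le; have hM := expd_levels_le.
have := heap_size_le d_gt1 (levels d N); move: hM.
have hw : width d (levels d N) b <= d ^ levels d N by exact: leq_subr.
rewrite /num_vertices /gadget_base /grafted_base; move: hw.
move: (levels d N) (heap_size _ _) (width _ _ _) (d ^ _) => k X w M hw hM hX hk.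
(* At most [2 * d * N] gadgets of at most [8 * D] vertices; with upper tree, paths and grafted tree
   the total is at most [21 * d * N * D]. *)
have hP : gadget_size D.-1 b <= 8 * D by rewrite /gadget_size; case: (b); lia.
have h1 : k.+1 * w <= 2 * (d * N * D).
  by rewrite [d * N * D]mulnC mulnA; apply: leq_mul; lia.
have h2 : (w + b * M) * gadget_size D.-1 b <= 16 * (d * N * D).
  have -> : 16 * (d * N * D) = 2 * (d * N) * (8 * D) by rewrite mulnACA.
  by apply: leq_mul => //; case: (b); lia.
have h3 : d * N <= d * N * D by rewrite leq_pmulr.
have h4 : b * (X + M) <= 2 * (d * N) by case: (b); lia.
rewrite (mulnA d); move: (d * N) (d * N * D) h1 h2 h3 h4 hM => e m *; lia.
Qed.

Lemma vector_tree_constructed (b : bool) (A : N.-tuple (D.-tuple bool)) : uniq A ->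
  constructs_in_time (1000 * (30 * d) * (N * D)) (construction d b) A
    (vector_tree d_gt1 b A) (1000 * (30 * d) * (N * D)).
Proof.
move=> hA; have -> : 1000 * (30 * d) * (N * D) = 1000 * (30 * (d * (N * D))).
  by rewrite !mulnA.
have hND : 0 < N * D by rewrite muln_gt0 N_gt0.
have hd : d <= d * (N * D) by rewrite leq_pmulr.
have hm : N * D <= d * (N * D) by rewrite leq_pmull // ltnW.
apply: construction_correct => //; try by [lia|exact: num_vertices_le hA].
have h1 := heap_size_le d_gt1 (levels d N); have h2 := expd_levels_le.
have h3 : d * N <= d * (N * D) by rewrite leq_mul2l leq_pmulr // orbT.
move: (heap_size _ _) (d ^ _) (d * N) (d * (N * D)) h1 h2 h3 => *; lia.
Qed.

Lemma tree_size_vector_tree (b : bool) (A : N.-tuple (D.-tuple bool)) : uniq A ->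
  tree_size (vector_tree d_gt1 b A) <= 1000 * (30 * d) * (N * D).
Proof.
move=> hA; apply: leq_trans (num_vertices_le b hA) _.
by rewrite -!mulnA; apply: leq_pmull.
Qed.

(** Stated with [k.-1], because it is [k - 1] that is bounded by the logarithm of [N] to base [d];
    this turns 7 into 9. *)
Lemma vector_tree_depth_le (b : bool) (A : N.-tuple (D.-tuple bool)) :
  depth (vector_tree d_gt1 b A) <= (levels d N).-1.*2 + 3 * trunc_log 2 D + 9.
Proof.
apply: leq_trans (tree_depth _ _ _ _ _) _; rewrite (prednK D_gt0).
by have := levels_gt0 d N; lia.
Qed.

End Bounds.

Import Order.TTheory GRing.Theory Num.Theory.
Local Open Scope ring_scope.

(** * The depth bound in real logarithms *)

Section LogarithmicDepth.

Variable R : realType.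

Lemma ln2_ge_half : 1 / 2 <= ln 2 :> R.
Proof.
(* The inequality [ln (1 + x) <= x] at [x = - 1 / 2]. *)
have := @le_ln1Dx R (- (1 / 2)); rewrite (_ : 1 + - (1 / 2) = 2^-1); last by field.
by rewrite lnV ?posrE ?ltr0n // => /(_ ltac:(lra)); lra.
Qed.

Lemma ln_expn_le (p m n : nat) : (0 < p)%N -> (p ^ m <= n)%N ->
  m%:R * ln p%:R <= ln n%:R :> R.
Proof.
move=> hp hmn; rewrite mulr_natl -lnXn ?ltr0n // -natrX ler_ln ?posrE ?ltr0n ?ler_nat //.
  by rewrite expn_gt0 hp.
by apply: leq_trans hmn; rewrite expn_gt0 hp.
Qed.

Lemma vector_tree_depth (d N D : nat) (d_gt1 : (1 < d)%N) (b : bool)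
    (A : N.-tuple (D.-tuple bool)) : (0 < N)%N -> (0 < D)%N ->
  (depth (vector_tree d_gt1 b A))%:R
    <= 2 * (ln N%:R / ln d%:R) + (1000 * (30 * d))%:R * ln D.+1%:R :> R.
Proof.
move=> N_gt0 D_gt0; have hdep := vector_tree_depth_le d_gt1 N_gt0 D_gt0 b A.
have lnd : 0 < ln d%:R :> R by rewrite ln_gt0 // ltr1n.
have hk : ((levels d N).-1)%:R <= ln N%:R / ln d%:R :> R.
  by rewrite ler_pdivlMr // ln_expn_le ?expd_levels_pred // ltnW.
have ht : (trunc_log 2 D)%:R * ln 2 <= ln D.+1%:R :> R.
  by apply: ln_expn_le => //; apply: leq_trans (trunc_logP _ _) (leqnSn _).
have h2 := ln2_ge_half.
have hl : ln 2 <= ln D.+1%:R :> R.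
  by rewrite ler_ln ?posrE ?ltr0n // ler_nat.
have ht2 : (trunc_log 2 D)%:R * (1 / 2) <= (trunc_log 2 D)%:R * ln 2 :> R.
  by rewrite ler_wpM2l.
(* As [ln 2 >= 1 / 2], the heap term is at most [6 * ln (D + 1)] and the constant 9 at most
   [18 * ln (D + 1)]. *)
have hC : 24 * ln D.+1%:R <= (1000 * (30 * d))%:R * ln D.+1%:R :> R.
  apply: ler_wpM2r; first by lra.
  rewrite ler_nat; lia.
have : (depth (vector_tree d_gt1 b A))%:R
    <= ((levels d N).-1.*2 + 3 * trunc_log 2 D + 9)%:R :> R by rewrite ler_nat.
move: (1000 * (30 * d))%N hC => C hC; rewrite !natrD -muln2 !natrM.
lra.
Qed.

End LogarithmicDepth.

Unset Implicit Arguments.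

Theorem theorem2p3 (R : realType) (d : nat) (hd : (2 <= d)%N) :
  exists (PH PG : prog)
         (H G : forall N D : nat, N.-tuple (D.-tuple bool) -> rtree)
         (C : nat),
  forall (N D : nat) (A B : N.-tuple (D.-tuple bool)),
    (0 < N)%N -> (0 < D)%N -> uniq A -> uniq B ->
    [/\ [/\ (tree_size (H N D A) <= C * (N * D))%N,
            (tree_size (G N D B) <= C * (N * D))%N,
            constructs_in_time (C * (N * D)) PH A (H N D A) (C * (N * D)) &
            constructs_in_time (C * (N * D)) PG B (G N D B) (C * (N * D))],
        (forall v, (#|children (T := H N D A) v| <= d)%N) /\
        (forall v, (#|children (T := G N D B) v| <= d)%N),
        (depth (H N D A))%:R
          <= 2 * (ln N%:R / ln d%:R) + C%:R * ln D.+1%:R :> R /\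
        (depth (G N D B))%:R
          <= 2 * (ln N%:R / ln d%:R) + C%:R * ln D.+1%:R :> R &
        isomorphic_to_subtree (H N D A) (G N D B) <->
        exists a b, [/\ a \in A, b \in B & dot a b = 0%N]].
Proof.
(* One constant serves as bound for vertices, time and word size and as coefficient of the logarithm
   of [D + 1]. *)
exists (construction d false), (construction d true),
  (vector_tree hd false), (vector_tree hd true), (1000 * (30 * d))%N.
move=> N D A B N_gt0 D_gt0 uA uB; split.
- by split; [exact: tree_size_vector_tree | exact: tree_size_vector_tree
            | exact: vector_tree_constructed | exact: vector_tree_constructed].
- by split=> v; apply: tree_degree.
- by split; apply: vector_tree_depth.
- exact: vector_tree_embeds.
Qed.
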